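(* Let $\alpha$ be a non-zero countable ordinal and $B$ a non-empty subset of $\mathcal{N}$. Then $B\in\mathbf{\Sigma}^1_\alpha(\mathcal{N})$ iff there is a continuous function $f\colon \mathbb{N}\langle\alpha\rangle\to \mathcal{N}$ with $\mathit{rng}(f)=B$.
   Context: $\mathcal{N}$ is the Baire space. The hyperprojective hierarchy of pointclasses is defined by $\mathbf{\Sigma}^1_0=\mathbf{\Sigma}^0_2$, $\mathbf{\Sigma}^1_{\alpha+1}(X)=\{\exists^{\mathcal{N}}(A)\mid A\subseteq\mathcal{N}\times X,\ (\mathcal{N}\times X)\setminus A\in\mathbf{\Sigma}^1_\alpha(\mathcal{N}\times X)\}$ (projections of complements), and for limit $\lambda$, $\mathbf{\Sigma}^1_\lambda(X)=$ projections along $\mathcal{N}$ of countable intersections of sets in $\bigcup_{\alpha<\lambda}\mathbf{\Sigma}^1_\alpha(\mathcal{N}\times X)$. The spaces of continuous functionals are defined in the category $\mathsf{QCB_0}$ of qcb$_0$-spaces by $\mathbb{N}\langle 0\rangle:=\omega$ (discrete), $\mathbb{N}\langle\alpha+1\rangle:=\omega^{\mathbb{N}\langle\alpha\rangle}$ ($\mathsf{QCB_0}$-exponential, i.e. continuous maps with the sequentialized compact-open topology), $\mathbb{N}\langle\lambda\rangle:=\prod_{\alpha<\lambda}\mathbb{N}\langle\alpha\rangle$ ($\mathsf{QCB_0}$-product) for countable limit $\lambda$; $\mathbb{N}\langle 1\rangle=\mathcal{N}$. *)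

(* Defs.v *)
From HB Require Import structures.
From mathcomp Require Import all_boot all_order all_algebra.
From mathcomp Require Import all_classical all_reals all_analysis.
From mathcomp Require Import borel_hierarchy.
Set Implicit Arguments.
Unset Strict Implicit.
Unset Printing Implicit Defensive.
Import Order.TTheory.
Local Open Scope classical_set_scope.
Local Open Scope order_scope.

(** Ordinals are elements of a well-ordered type: [a : W] stands for the order
    type of [set b | b < a].  Every ordinal arises in this way. *)
Section ordinals.
Context {d : Order.disp_t} {W : orderType d}.
Implicit Types a b c : W.

Definition ord_zero a : Prop := forall b, a <= b.

Definition ord_succ b a : Prop := b < a /\ forall c, b < c -> a <= c.

Definition ord_limit a : Prop := ~ ord_zero a /\ ~ exists b, ord_succ b a.

Definition countable_ord a : Prop := countable [set b | b < a].

Inductive ord_cases a : Type :=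
  | OrdZero of ord_zero a
  | OrdSucc b of ord_succ b a
  | OrdLimit of ord_limit a.

Definition ord_case a : ord_cases a :=
  match pselect (ord_zero a), pselect (exists b, ord_succ b a) with
  | left a0, _ => OrdZero a0
  | right _, left aS => OrdSucc (projT2 (cid aS))
  | right an0, right anS => OrdLimit (conj an0 anS)
  end.

Lemma ord_succ_inj a b b' : ord_succ b a -> ord_succ b' a -> b = b'.
Proof.
move=> [ba bmin] [b'a b'min].
have [bb'|b'b|//] := ltgtP b b'.
  by have := bmin _ bb'; rewrite leNgt b'a.
by have := b'min _ b'b; rewrite leNgt ba.
Qed.

Lemma ord_succ_neq0 a b : ord_succ b a -> ~ ord_zero a.
Proof. by case=> ba _ /(_ b); rewrite leNgt ba. Qed.

End ordinals.

(** [seq_top X] is [X] with the topology of its sequentially open sets. *)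
Definition seq_top (X : topologicalType) : Type := X.

Section seq_top.
Context {X : topologicalType}.

Definition seq_open (U : set X) : Prop :=
  forall (u : nat -> X) (x : X),
    U x -> u @ \oo --> x -> \forall n \near \oo, U (u n).

Let seq_openT : seq_open setT.
Proof. by move=> u x _ _; exists 0%N. Qed.

Let seq_openI : setI_closed seq_open.
Proof.
move=> A B oA oB u x [Ax Bx] ux.
by apply: filterI; [exact: oA Ax ux | exact: oB Bx ux].
Qed.

Let seq_open_bigU (I : Type) (f : I -> set X) :
  (forall i, seq_open (f i)) -> seq_open (\bigcup_i f i).
Proof.
move=> fo u x [i _ fix_] ux; have := fo i u x fix_ ux.
by apply: filterS => n ?; exists i.
Qed.

HB.instance Definition _ := Choice.on (seq_top X).
HB.instance Definition _ :=
  isOpenTopological.Build (seq_top X) seq_openT seq_openI seq_open_bigU.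

End seq_top.

(** In QCB0, exponentials and countable products are obtained by
    sequentializing the compact-open topology on continuous maps and the
    Tychonoff topology respectively. *)
Definition qcb_exp (X Y : topologicalType) : topologicalType :=
  seq_top (initial_topology
    (fun f : continuousType X Y => (f : X -> Y) : {compact-open, X -> Y})).

Definition qcb_prod (I : Type) (X : I -> topologicalType) : topologicalType :=
  seq_top (prod_topology X).

Section continuous_functionals.
Context {d : Order.disp_t} {W : orderType d}.
Variable wfW : well_founded (fun a b : W => a < b).

Definition cont_functionals_step (a : W)
    (N : forall b : W, b < a -> topologicalType) : topologicalType :=
  match ord_case a with
  | OrdZero _ => nat
  | OrdSucc b ba => qcb_exp (N b (proj1 ba)) nat
  | OrdLimit _ => qcb_prod (fun b : {b : W | b < a} => N (sval b) (svalP b))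
  end.

Definition cont_functionals : W -> topologicalType :=
  Fix wfW (fun=> topologicalType) cont_functionals_step.

Lemma cont_functionalsE a :
  cont_functionals a = cont_functionals_step (fun b (_ : b < a) => cont_functionals b).
Proof.
rewrite /cont_functionals Fix_eq// => {}a N N' NN'.
by congr cont_functionals_step; apply: functional_extensionality_dep => b;
  apply: functional_extensionality_dep => ba; exact: NN'.
Qed.

Lemma cont_functionals0 a : ord_zero a -> cont_functionals a = nat.
Proof.
move=> a0; rewrite cont_functionalsE /cont_functionals_step.
by case: ord_case => [//|b /ord_succ_neq0//|[]].
Qed.

Lemma cont_functionalsS b a : ord_succ b a ->
  cont_functionals a = qcb_exp (cont_functionals b) nat.
Proof.
move=> ba; rewrite cont_functionalsE /cont_functionals_step.
case: ord_case => [/(ord_succ_neq0 ba)//|b' b'a|[_ []]]; last by exists b.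
by rewrite (ord_succ_inj ba b'a).
Qed.

Lemma cont_functionals_lim a : ord_limit a ->
  cont_functionals a =
  qcb_prod (fun b : {b : W | b < a} => cont_functionals (sval b)).
Proof.
move=> [an0 anS]; rewrite cont_functionalsE /cont_functionals_step.
by case: ord_case => [//|b ba|//]; case: anS; exists b.
Qed.

End continuous_functionals.

Definition baire : topologicalType := {ptws nat -> nat}.

Definition exists_baire (X : Type) (C : set (baire * X)) : set X :=
  [set x | exists p : baire, C (p, x)].

(** [Sigma11 a A] means that [A] is in Sigma^1_a(X).  The bottom level is
    Sigma^0_2, which is [Fsigma] on metrizable spaces; starting from the Baire
    space, the recursion only visits its finite powers. *)
Inductive Sigma11 (d : Order.disp_t) (W : orderType d) (a : W)
    (X : topologicalType) (A : set X) : Prop :=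
  | Sigma11_zero of ord_zero a & Fsigma A
  | Sigma11_succ (b : W) (C : set (baire * X)%type) of
      ord_succ b a & Sigma11 b (~` C) & A = exists_baire C
  | Sigma11_limit (b : nat -> W) (C : nat -> set (baire * X)%type) of
      ord_limit a & (forall n, b n < a) & (forall n, Sigma11 (b n) (C n)) &
      A = exists_baire (\bigcap_n C n).

(* Main.v *)
Require Import Defs.
From mathcomp Require Import all_boot all_order all_algebra.
From mathcomp Require Import all_classical all_reals all_analysis.
From mathcomp Require Import borel_hierarchy.
Set Implicit Arguments.
Unset Strict Implicit.
Unset Printing Implicit Defensive.
Import Order.TTheory.
Local Open Scope order_scope.
Local Open Scope classical_set_scope.

(** Upper bound.  By induction on the level, the points of each space of
    continuous functionals are named by sequences in the Baire space, so that
    points depend continuously on their names and convergent sequences of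
    points lift to convergent sequences of names (an admissible
    representation): a name of a functional tabulates its values on finite
    prefixes of names of arguments.  Two sequences name the same functional iff
    a G_delta matching condition holds for all pairs of names of a common
    argument; this adds one universal quantifier per level.  A continuous image
    [B] of the space is then a projection of the set of names intersected with
    the closure of a graph.

    Lower bound.  The projection of a set given by countably many clopen
    tests on [X] is a continuous image of [X]: follow the point as long as the
    tests hold and its prefix is still extendable in the target, otherwise jump
    into the target.  If [C] is the range of a continuous [g] on [X], then
    [y] lies outside [C] iff a continuous [F : X -> nat] satisfies
    [g x | F x <> y | F x] for all [x], which may be tested on a dense sequence
    of [X]; so the complement of [C] is a continuous image of [nat^X].  At
    limits, an intersection of ranges is a coincidence set in the product. *)

(** * Locally constant maps and the Baire space *)

Section locally_constant.
Context {X : topologicalType}.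

(** With values in [nat] this is continuity; with values in [Prop] it says that the set is clopen,
    so clopen tests compose like functions. *)
Definition locally_constant (T : Type) (f : X -> T) : Prop :=
  forall x, \forall x' \near x, f x' = f x.

Lemma locally_constant_cst (T : Type) (t : T) : locally_constant (fun=> t).
Proof. by move=> x; exact: nearW. Qed.

Lemma locally_constant_bind (T S : Type) (f : X -> T) (g : T -> X -> S) :
  locally_constant f -> (forall t, locally_constant (g t)) ->
  locally_constant (fun x => g (f x) x).
Proof.
move=> fl gl x; near=> y.
have -> : f y = f x by near: y; exact: fl.
by near: y; exact: gl.
Unshelve. all: by end_near. Qed.

Lemma locally_constant_comp (T S : Type) (F : T -> S) (f : X -> T) :
  locally_constant f -> locally_constant (fun x => F (f x)).
Proof. by move=> fl x; move: (fl x); apply: filterS => y ->. Qed.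

Lemma locally_constant_comp2 (T S U : Type) (F : T -> S -> U)
    (f : X -> T) (g : X -> S) :
  locally_constant f -> locally_constant g ->
  locally_constant (fun x => F (f x) (g x)).
Proof.
move=> fl gl.
apply: (locally_constant_bind (g := fun t x => F t (g x)) fl) => t.
exact: locally_constant_comp.
Qed.

Lemma locally_constant_open (P : set X) : locally_constant P -> open P.
Proof.
by move=> Pl; rewrite openE => x Px; move: (Pl x); apply: filterS => y ->.
Qed.

Lemma locally_constant_closed (P : set X) : locally_constant P -> closed P.
Proof.
move=> Pl; rewrite -openC; apply: locally_constant_open.
exact: (locally_constant_comp not Pl).
Qed.

Lemma cvg_locally_constant (T : Type) (f : X -> T) (u : nat -> X) x :
  locally_constant f -> u @ \oo --> x -> \forall n \near \oo, f (u n) = f x.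
Proof. by move=> fl ux; exact: ux (fl x). Qed.

Lemma continuous_natP (f : X -> nat) : continuous f <-> locally_constant f.
Proof.
split=> fc x; first exact: (fc x _ (discrete_set1 _)).
by move: (fc x) => fx; apply/(@discrete_cvg nat).
Qed.

End locally_constant.

Lemma locally_constant_precomp (X Y : topologicalType) (T : Type) (h : Y -> X)
    (f : X -> T) : continuous h -> locally_constant f ->
  locally_constant (f \o h).
Proof. by move=> hc fl y; exact: (hc y _ (fl (h y))). Qed.


Lemma cvg_natP (u : nat -> nat) k :
  u @ \oo --> k <-> \forall n \near \oo, u n = k.
Proof. by split => [/(@discrete_cvg nat)//|?]; apply/(@discrete_cvg nat). Qed.

Lemma cvg_prodP (I : Type) (X : I -> topologicalType) (T : Type)
    (F : set_system T) (FF : Filter F) (f : T -> prod_topology X)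
    (p : prod_topology X) :
  f @ F --> p <-> forall i, (fun t => f t i) @ F --> p i.
Proof.
split=> [fp i|fp].
  have pi : continuous (fun g : prod_topology X => g i).
    exact: (@proj_continuous {classic I}).
  exact: (cvg_trans (cvg_app _ fp) (pi p)).
apply/cvg_sup => i U [V [[W oW <-] Wpi] WU].
apply: (filterS WU); apply: (fp i W).
exact: open_nbhs_nbhs.
Qed.

Lemma cvg_baireP (u : nat -> baire) (p : baire) :
  u @ \oo --> p <-> forall n, \forall k \near \oo, u k n = p n.
Proof.
split => [/cvg_prodP up n|up]; first exact/cvg_natP/up.
by apply/cvg_prodP => n; exact/cvg_natP/up.
Qed.

Lemma continuous_baireP (X : topologicalType) (f : X -> baire) :
  continuous f <-> forall n, locally_constant (fun x => f x n).
Proof.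
split=> [fc n|fl x].
  by apply/continuous_natP => x; move: (fc x) => /cvg_prodP; exact.
by apply/cvg_prodP => n; move/continuous_natP: (fl n) => /(_ x).
Qed.

Lemma locally_constant_eval n : locally_constant (fun p : baire => p n).
Proof. by move: n; apply/continuous_baireP => p; exact: cvg_id. Qed.

Definition initseg (p : baire) (m : nat) : seq nat := [seq p i | i <- iota 0 m].

Lemma initsegP (p q : baire) m :
  initseg p m = initseg q m <-> forall i, (i < m)%N -> p i = q i.
Proof.
split=> [/eq_in_map pq i im|pq]; first by apply: pq; rewrite mem_iota.
by apply/eq_in_map => i; rewrite mem_iota => /andP[_]; exact: pq.
Qed.

Lemma size_initseg p m : size (initseg p m) = m.
Proof. by rewrite size_map size_iota. Qed.

Lemma initseg_leq (p q : baire) m n : (m <= n)%N ->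
  initseg p n = initseg q n -> initseg p m = initseg q m.
Proof.
move=> mn /initsegP pq; apply/initsegP => i im.
by apply: pq; exact: leq_trans mn.
Qed.

Lemma locally_constant_initseg (X : topologicalType) (f : X -> baire) m :
  continuous f -> locally_constant (fun x => initseg (f x) m).
Proof.
move=> fc; apply: (locally_constant_precomp fc (f := initseg^~ m)).
elim: m => [|m IH]; first exact: locally_constant_cst.
rewrite (_ : initseg^~ m.+1 = fun p => rcons (initseg p m) (p m)).
  exact: (locally_constant_comp2 (fun s => rcons s) IH (locally_constant_eval _)).
by apply/funext => p; rewrite /initseg -cats1 -addn1 iotaD map_cat.
Qed.

Lemma cvg_initseg (u : nat -> baire) p :
  (forall n, initseg (u n) n = initseg p n) -> u @ \oo --> p.
Proof.
move=> up; apply/cvg_baireP => n; exists n.+1 => // k /= nk.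
by have /initsegP/(_ n nk) := up k.
Qed.

Lemma nbhs_initseg (p : baire) (U : set baire) : nbhs p U ->
  exists m, forall q, initseg q m = initseg p m -> U q.
Proof.
move=> pU; apply: contrapT => /forallNP nU.
have /choice[u uP] m : exists q, initseg q m = initseg p m /\ ~ U q.
  by have /existsNP[q /not_implyP[]] := nU m; exists q.
have : u @ \oo --> p by apply: cvg_initseg => n; case: (uP n).
move=> /(_ _ pU)[m _ /(_ m (leqnn m))]; exact: (uP m).2.
Qed.

(** Follow [pi] as long as all tests passed and the prefix read so far still
    extends to a point of the target; once this fails, jump to such a point. *)
Lemma closed_projection_range (X : topologicalType) (T : nat -> set X)
    (pi : X -> baire) :
  (forall i, locally_constant (T i)) -> continuous pi ->
  (\bigcap_i T i) !=set0 ->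
  exists h : X -> baire, continuous h /\ range h = pi @` (\bigcap_i T i).
Proof.
move=> Tl pic [x0 Tx0]; set S := pi @` _.
have Spi0 : S (pi x0) by exists x0.
(* The default [pi x0] keeps every value of [z] in [S]. *)
pose z (s : seq nat) := xget (pi x0) [set y | S y /\ initseg y (size s) = s].
have zS s : S (z s) by rewrite /z; case: xgetP => [y _ []|].
have zpre y m : S y -> initseg (z (initseg y m)) m = initseg y m.
  move=> Sy; rewrite /z; case: xgetP => [y' _ []|/(_ y)[]].
    by rewrite size_initseg.
  by rewrite size_initseg.
(* Test [i] also secures the prefix of length [i.+1]. If [k] is the first failure, the prefix of
   length [k] is thus still extendable, and the jump made there preserves the first [k] values. *)
pose T' i x := T i x /\ exists2 y, S y & initseg y i.+1 = initseg (pi x) i.+1.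
have T'l i : locally_constant (T' i).
  apply: (locally_constant_comp2
    (fun P s => P /\ exists2 y, S y & initseg y i.+1 = s) (Tl i)).
  exact: locally_constant_initseg.
pose h x := if pselect (exists i, `[< ~ T' i x >]) is left e
  then z (initseg (pi x) (ex_minn e)) else pi x.
have hE x i : ~ T' i x -> (forall j, (j < i)%N -> T' j x) ->
    h x = z (initseg (pi x) i).
  move=> nTi Tj; rewrite /h; case: pselect => [e|[]]; last first.
    by exists i; exact/asboolP.
  case: ex_minnP => k /asboolP nTk kmin; congr (z (initseg _ _)).
  apply/eqP; rewrite eqn_leq kmin ?andbT; last exact/asboolP.
  by rewrite leqNgt; apply/negP => ki; exact: (nTk (Tj _ ki)).
have hT x n : (forall j, (j <= n)%N -> T' j x) -> h x n = pi x n.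
  move=> Tj; rewrite /h; case: pselect => // e.
  case: ex_minnP => k /asboolP nTk kmin.
  have nk : (n < k)%N by rewrite ltnNge; apply/negP => /Tj.
  have [_ [y Sy ypre]] := Tj n (leqnn n).
  have [k' kE] : exists k', k = k'.+1 by case: (k) nk => // k'; exists k'.
  have : T' k' x.
    apply: contrapT => nT; have := kmin k'.
    by rewrite kE ltnn => /(_ (asboolT nT)).
  move=> [_ [y' Sy' y'pre]].
  by have /initsegP := zpre y' k Sy'; rewrite {2 3}kE y'pre -kE => /(_ _ nk) ->;
    move/initsegP: y'pre => ->//; rewrite -kE.
exists h; split.
  apply/continuous_baireP => n x.
  (* Finitely many tests decide the value at [n]: either all up to [n] pass near [x], or the first
     failure, and hence the jump, is the same near [x]. *)
  have nearT m : \forall x' \near x, forall j, (j < m)%N -> T' j x' = T' j x.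
    elim: m => [|m IH]; first exact: nearW.
    near=> x' => j; rewrite ltnS leq_eqVlt => /orP[/eqP ->|jm].
      by near: x'; exact: T'l.
    by move: j jm; near: x'; exact: IH.
  have [allT|] := pselect (forall j, (j <= n)%N -> T' j x).
    near=> x'; rewrite !hT//; first by near: x'; exact: (continuous_baireP _).1 pic n x.
    move=> j jn; have -> : T' j x' = T' j x.
      by move: j jn; near: x'; exact: (nearT n.+1).
    exact: allT.
  move=> /existsNP[j0 /not_implyP[_ nTj0]].
  have e : exists i, `[< ~ T' i x >] by exists j0; exact/asboolP.
  case: (ex_minnP e) => i /asboolP nTi imin.
  have Tj j : (j < i)%N -> T' j x.
    move=> ji; apply: contrapT => nT; have := imin j (asboolT nT).
    by rewrite leqNgt ji.
  near=> x'.
  have T'E j : (j < i.+1)%N -> T' j x' = T' j x.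
    by move: j; near: x'; exact: nearT.
  rewrite !(@hE _ i)//; first congr (z _ n).
  - by near: x'; exact: locally_constant_initseg.
  - by rewrite T'E.
  - by move=> j ji; rewrite T'E; [exact: Tj|exact: leqW].
apply/seteqP; split=> [_ [x _ <-]|_ [x Tx <-]].
  rewrite /h; case: pselect => [e|ne]; first exact: zS.
  exists x => // i _; apply: contrapT => nT; apply: ne.
  by exists i; apply/asboolP => -[].
exists x => //; apply/funext => n; apply: hT => j _; split; first exact: Tx.
by exists (pi x) => //; exists x.
Unshelve. all: by end_near. Qed.

(** * Closure properties of the hierarchy *)

Lemma comp_continuous (X Y Z : topologicalType) (f : X -> Y) (g : Y -> Z) :
  continuous f -> continuous g -> continuous (g \o f).
Proof. by move=> fc gc x; apply: continuous_comp; [exact: fc|exact: gc]. Qed.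

Lemma pair_continuous (X Y Z : topologicalType) (f : X -> Y) (g : X -> Z) :
  continuous f -> continuous g -> continuous (fun x => (f x, g x)).
Proof. by move=> fc gc x; apply: cvg_pair; [exact: fc|exact: gc]. Qed.

Lemma fst_continuous (X Y : topologicalType) : continuous (@fst X Y).
Proof. by move=> x; exact: cvg_fst. Qed.

Lemma snd_continuous (X Y : topologicalType) : continuous (@snd X Y).
Proof. by move=> x; exact: cvg_snd. Qed.

(** * Coding pairs and sequences of points of Baire space *)

Definition decode_pair (j : nat) : nat * nat := odflt (0, 0)%N (unpickle j).

Lemma pickle_pairK : cancel pickle decode_pair.
Proof. by move=> x; rewrite /decode_pair pickleK. Qed.

Definition baire_pair (p q : baire) : baire :=
  fun n => if odd n then q n./2 else p n./2.
Definition baire_fst (p : baire) : baire := fun n => p n.*2.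
Definition baire_snd (p : baire) : baire := fun n => p n.*2.+1.

Lemma baire_pairK1 p q : baire_fst (baire_pair p q) = p.
Proof.
by apply/funext => n; rewrite /baire_fst /baire_pair odd_double doubleK.
Qed.

Lemma baire_pairK2 p q : baire_snd (baire_pair p q) = q.
Proof.
apply/funext => n.
by rewrite /baire_snd /baire_pair /= odd_double uphalf_double.
Qed.

Definition baire_join (u : nat -> baire) : baire :=
  fun j => u (decode_pair j).1 (decode_pair j).2.
Definition baire_nth (n : nat) (p : baire) : baire := fun m => p (pickle (n, m)).

Lemma baire_joinK u n : baire_nth n (baire_join u) = u n.
Proof. by apply/funext => m; rewrite /baire_nth /baire_join pickle_pairK. Qed.

Lemma baire_fst_continuous : continuous baire_fst.
Proof. by apply/continuous_baireP => n; exact: locally_constant_eval. Qed.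

Lemma baire_snd_continuous : continuous baire_snd.
Proof. by apply/continuous_baireP => n; exact: locally_constant_eval. Qed.

Lemma baire_nth_continuous n : continuous (baire_nth n).
Proof. by apply/continuous_baireP => m; exact: locally_constant_eval. Qed.

Lemma baire_pair_continuous (X : topologicalType) (f g : X -> baire) :
  continuous f -> continuous g -> continuous (fun x => baire_pair (f x) (g x)).
Proof.
move=> /continuous_baireP fl /continuous_baireP gl; apply/continuous_baireP => n.
by rewrite /baire_pair; case: (odd n).
Qed.

Section Fsigma.
Context {X : topologicalType}.

Lemma Fsigma_preimage (Y : topologicalType) (f : Y -> X) A :
  continuous f -> Fsigma A -> Fsigma (f @^-1` A).
Proof.
move=> fc [F Fc ->]; exists (fun i => f @^-1` F i).
  by move=> i; exact: preimage_closed.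
by rewrite preimage_bigcup.
Qed.

Lemma Fsigma_bigcup (A : nat -> set X) :
  (forall n, Fsigma (A n)) -> Fsigma (\bigcup_n A n).
Proof.
move=> FA.
have /choice[F FP] n : exists F : nat -> set X,
    (forall i, closed (F i)) /\ A n = \bigcup_i F i.
  by have [F ? ?] := FA n; exists F.
exists (fun j => F (decode_pair j).1 (decode_pair j).2).
  by move=> j; exact: (FP _).1.
apply/seteqP; split=> [x [n _]|x [j _ Fx]]; last first.
  by exists (decode_pair j).1 => //; rewrite (FP _).2; exists (decode_pair j).2.
rewrite (FP n).2 => -[i _ Fx]; exists (pickle (n, i)) => //.
by rewrite pickle_pairK.
Qed.

Lemma Fsigma_setI (A B : set X) : Fsigma A -> Fsigma B -> Fsigma (A `&` B).
Proof.
move=> [F Fc ->] [G Gc ->]; rewrite setI_bigcupr.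
apply: Fsigma_bigcup => j; exists (fun i => F i `&` G j); last first.
  by rewrite setI_bigcupl.
by move=> i; exact: closedI.
Qed.

End Fsigma.

(** Stands in for metrizability: it makes open sets F_sigma, and it passes from [X] to [baire * X],
    hence to every space that the recursion visits from Baire space. *)
Definition baire_retract (X : topologicalType) : Prop :=
  exists (g : X -> baire) (r : baire -> X),
    [/\ continuous g, continuous r & cancel g r].

Lemma baire_retract_id : baire_retract baire.
Proof. by exists id, id; split=> // x; exact: cvg_id. Qed.

Lemma baire_retract_prod (X : topologicalType) :
  baire_retract X -> baire_retract (baire * X)%type.
Proof.
move=> [g [r [gc rc gK]]].
exists (fun z => baire_pair z.1 (g z.2)), (fun p => (baire_fst p, r (baire_snd p))).
split=> [||[p x]]; last by rewrite baire_pairK1 baire_pairK2 gK.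
  apply: baire_pair_continuous; first exact: fst_continuous.
  by apply: comp_continuous gc; exact: snd_continuous.
apply: pair_continuous; first exact: baire_fst_continuous.
by apply: comp_continuous rc; exact: baire_snd_continuous.
Qed.

(** An open set is the union of the countably many cylinders that it contains, and cylinders are
    clopen. *)
Lemma baire_open_Fsigma (U : set baire) : open U -> Fsigma U.
Proof.
move=> Uo; pose s j : seq nat := odflt [::] (unpickle j).
pose cyl j := [set p | initseg p (size (s j)) = s j].
have cylc j : closed (cyl j).
  apply: locally_constant_closed.
  apply: (locally_constant_comp (eq^~ (s j))).
  by apply: (@locally_constant_initseg baire id) => x; exact: cvg_id.
exists (fun j => [set p | cyl j `<=` U] `&` cyl j).
  move=> j; have [cU|ncU] := pselect (cyl j `<=` U).
    rewrite (_ : _ `&` _ = cyl j)//.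
    by apply/seteqP; split=> [p []|p ?].
  rewrite (_ : _ `&` _ = set0); first exact: closed0.
  by apply/seteqP; split=> [p []|p].
apply/seteqP; split=> [p Up|p [j _ [cU cp]]]; last exact: cU.
have [m mU] := nbhs_initseg (open_nbhs_nbhs (conj Uo Up)).
exists (pickle (initseg p m)) => //; rewrite /cyl /s pickleK /= size_initseg.
by split => // q /= ?; exact: mU.
Qed.

Lemma open_Fsigma (X : topologicalType) (U : set X) :
  baire_retract X -> open U -> Fsigma U.
Proof.
move=> [g [r [gc rc gK]]] Uo.
rewrite (_ : U = g @^-1` (r @^-1` U)); last first.
  by apply/seteqP; split=> x /=; rewrite gK.
apply: Fsigma_preimage => //; apply: baire_open_Fsigma.
by move/continuousP: rc; exact.
Qed.

(** * Levels of the hierarchy *)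

Section ordinals.
Context {d : Order.disp_t} {W : orderType d}.
Hypothesis wfW : well_founded (fun a b : W => a < b).
Implicit Types a b c : W.

(** Well-founded descent: anything strictly between [b] and [a] replaces [a]; if there is nothing,
    [a] itself is the successor. *)
Lemma ord_succ_exists a b : b < a -> exists2 c, ord_succ b c & c <= a.
Proof.
elim/(well_founded_ind wfW): a => a IH ba.
have [[c [bc ca]]|nc] := pselect (exists c, b < c /\ c < a).
  have [e be ec] := IH _ ca bc; exists e => //.
  exact: le_trans ec (ltW ca).
exists a => //; split => // c bc.
by rewrite leNgt; apply/negP => ca; apply: nc; exists c.
Qed.

Lemma ord_limit_succ a b : ord_limit a -> b < a ->
  exists2 c, ord_succ b c & c < a.
Proof.
move=> [_ aS] ba; have [c bc ca] := ord_succ_exists ba; exists c => //.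
rewrite lt_neqAle ca andbT; apply/eqP => cE.
by apply: aS; exists b; rewrite -cE.
Qed.

Lemma not_ord_zero a : ~ ord_zero a -> exists b, b < a.
Proof. by move=> /existsNP[b /negP]; rewrite -ltNge; exists b. Qed.

Lemma ord_succ_le b a c : ord_succ b a -> c < a -> c <= b.
Proof. by move=> [_ bmin] ca; rewrite leNgt; apply/negP => /bmin; rewrite leNgt ca. Qed.

Lemma Sigma11_zeroE a (X : topologicalType) (A : set X) :
  ord_zero a -> Sigma11 a A <-> Fsigma A.
Proof.
move=> a0; split=> [|FA]; last exact: Sigma11_zero.
by case=> [//|b C /ord_succ_neq0/(_ a0)|b C []].
Qed.

Lemma Sigma11_succE b a (X : topologicalType) (A : set X) : ord_succ b a ->
  Sigma11 a A <-> exists C, Sigma11 b (~` C) /\ A = exists_baire C.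
Proof.
move=> ba; split=> [|[C [SC AE]]]; last exact: (Sigma11_succ ba SC AE).
case=> [/(ord_succ_neq0 ba)//|b' C b'a SC AE|b' C [_ []]]; last by exists b.
by rewrite (ord_succ_inj ba b'a); exists C.
Qed.

Lemma Sigma11_limitE a (X : topologicalType) (A : set X) : ord_limit a ->
  Sigma11 a A <-> exists (b : nat -> W) (C : nat -> set (baire * X)%type),
    [/\ forall n, b n < a, forall n, Sigma11 (b n) (C n) &
      A = exists_baire (\bigcap_n C n)].
Proof.
move=> al; split=> [|[b [C [ba SC AE]]]]; last exact: (Sigma11_limit al ba SC AE).
case=> [a0|b C ba|b C _ ba SC AE]; last by exists b, C.
  by case: al.
by case: al => _ []; exists b.
Qed.

Lemma Sigma11_preimage a (X Y : topologicalType) (f : Y -> X) (A : set X) :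
  continuous f -> Sigma11 a A -> Sigma11 a (f @^-1` A).
Proof.
elim/(well_founded_ind wfW): a X Y f A => a IH X Y f A fc.
have f'c : continuous (fun z : baire * Y => (z.1, f z.2)).
  apply: pair_continuous; first exact: fst_continuous.
  by apply: comp_continuous fc; exact: snd_continuous.
case=> [a0 FA|b C ba SC ->|b C al ba SC ->].
- exact/(Sigma11_zeroE _ a0)/Fsigma_preimage.
- apply/(Sigma11_succE _ ba); exists [set z | C (z.1, f z.2)]; split=> //.
  exact: (IH _ ba.1 _ _ _ _ f'c SC).
- apply/(Sigma11_limitE _ al).
  exists b, (fun n => [set z | C n (z.1, f z.2)]); split=> // n.
  exact: (IH _ (ba n) _ _ _ _ f'c (SC n)).
Qed.

Lemma Sigma11_cst a (X : topologicalType) (P : Prop) :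
  Sigma11 a [set _ : X | P].
Proof.
elim/(well_founded_ind wfW): a X P => a IH X P.
have [a0|b ba|al] := ord_case a.
- apply/(Sigma11_zeroE _ a0); apply: closed_Fsigma; apply: locally_constant_closed.
  exact: locally_constant_cst.
- apply/(Sigma11_succE _ ba); exists [set _ | P]; split; first exact: (IH _ ba.1 _ (~ P)).
  by apply/seteqP; split=> [x Px|x []//]; exists (fun=> 0%N).
- have [b ba] := not_ord_zero al.1.
  apply/(Sigma11_limitE _ al); exists (fun=> b), (fun=> [set _ | P]).
  split=> //; first by move=> _; exact: IH.
  apply/seteqP; split=> [x Px|x [p /(_ 0%N)]]; last exact.
  by exists (fun=> 0%N).
Qed.

(** A countable clopen partition costs no complexity. This lets a natural number be read off a Baire
    witness, which turns countable unions into projections. *)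
Lemma Sigma11_glue a (X : topologicalType) (k : X -> nat) (A : nat -> set X) :
  locally_constant k -> (forall n, Sigma11 a (A n)) ->
  Sigma11 a [set x | A (k x) x].
Proof.
elim/(well_founded_ind wfW): a X k A => a IH X k A kl SA.
have k'l : locally_constant (k \o @snd baire X).
  by apply: locally_constant_precomp kl; exact: snd_continuous.
have [a0|b ba|al] := ord_case a.
- apply/(Sigma11_zeroE _ a0).
  rewrite (_ : [set x | _] = \bigcup_n ([set x | k x = n] `&` A n)); last first.
    by apply/seteqP; split=> [x Ax|x [n _ [/= -> //]]]; exists (k x).
  apply: Fsigma_bigcup => n; apply: Fsigma_setI.
    apply: closed_Fsigma; apply: locally_constant_closed.
    exact: (locally_constant_comp (eq^~ n)).
  by move: (SA n) => /(Sigma11_zeroE _ a0).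
- have /choice[C CP] n : exists C, Sigma11 b (~` C) /\ A n = exists_baire C.
    exact/(Sigma11_succE _ ba).
  apply/(Sigma11_succE _ ba); exists [set z | C (k z.2) z]; split.
    apply: (IH _ ba.1 _ _ (fun n => ~` C n) k'l) => n; exact: (CP n).1.
  by apply/seteqP; split=> x /=; rewrite (CP _).2.
- have /choice[b /choice[C CP]] n :
      exists (b : nat -> W) (C : nat -> set (baire * X)%type),
      [/\ forall m, b m < a, forall m, Sigma11 (b m) (C m) &
        A n = exists_baire (\bigcap_m C m)].
    exact/(Sigma11_limitE _ al).
  apply/(Sigma11_limitE _ al).
  (* The levels of the pieces need not be bounded uniformly below [a], so the matrices are not
     glued. The intersection runs over all pairs [(n, m)], and [C n m] is imposed only where [k]
     equals [n]. *)
  exists (fun j => b (decode_pair j).1 (decode_pair j).2).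
  exists (fun j => [set z | k z.2 = (decode_pair j).1 ->
    C (decode_pair j).1 (decode_pair j).2 z]).
  split=> [j|j|]; first by case: (CP (decode_pair j).1).
    move: (decode_pair j) => -[n m] /=; have [bn SC _] := CP n.
    (* The implication is itself a glued set at the lower level: [C n m] on piece [n], everything
       elsewhere. *)
    pose D i := if i == n then C n m else setT.
    rewrite (_ : [set z | _] = [set z | D ((k \o snd) z) z]); last first.
      rewrite /D; apply/seteqP; split=> z /=; last by move=> + kn; rewrite kn eqxx.
      by case: eqVneq => // kn; exact.
    apply: (IH _ (bn m)) => // i; rewrite /D; case: ifP => // _.
    exact: (Sigma11_cst _ _ True).
  apply/seteqP; split=> x /=.
    have [_ _ ->] := CP (k x) => -[p Cp]; exists p => j _ /= kx.
    by rewrite -kx; exact: Cp.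
  have [_ _ ->] := CP (k x) => -[p Cp]; exists p => m _.
  by have := Cp (pickle (k x, m)) I; rewrite /= pickle_pairK /=; exact.
Qed.

(** Above level 0 the set already begins with a projection, and two consecutive Baire witnesses
    merge into one by pairing. *)
Lemma Sigma11_exists a (X : topologicalType) (C : set (baire * X)) :
  ~ ord_zero a -> Sigma11 a C -> Sigma11 a (exists_baire C).
Proof.
move=> an0.
pose f (z : baire * X) : baire * (baire * X) := (baire_fst z.1, (baire_snd z.1, z.2)).
have fc : continuous f.
  apply: pair_continuous; last apply: pair_continuous (@snd_continuous _ _).
    by apply: comp_continuous baire_fst_continuous; exact: fst_continuous.
  by apply: comp_continuous baire_snd_continuous; exact: fst_continuous.
have fE (D : set (baire * (baire * X))) :
    exists_baire (exists_baire D) = exists_baire (f @^-1` D).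
  apply/seteqP; split=> [x [q [p Dpqx]]|x [r Dr]]; last first.
    by exists (baire_snd r), (baire_fst r).
  by exists (baire_pair p q); rewrite /f /= baire_pairK1 baire_pairK2.
case=> [//|b D ba SD ->|b D al ba SD ->].
- apply/(Sigma11_succE _ ba); exists (f @^-1` D); split; last exact: fE.
  exact: (Sigma11_preimage fc SD).
- apply/(Sigma11_limitE _ al); exists b, (fun n => f @^-1` D n).
  by split=> // n; exact: Sigma11_preimage.
Qed.

Lemma exists_baire_snd (X : topologicalType) (A : set X) :
  exists_baire (snd @^-1` A) = A.
Proof. by apply/seteqP; split=> [x []//|x Ax]; exists (fun=> 0%N). Qed.

Lemma Sigma11_compl_succ b a (X : topologicalType) (A : set X) :
  ord_succ b a -> Sigma11 b (~` A) -> Sigma11 a A.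
Proof.
move=> ba SA; apply/(Sigma11_succE _ ba); exists (snd @^-1` A).
split; last by rewrite exists_baire_snd.
exact: (Sigma11_preimage (@snd_continuous _ _) SA).
Qed.

Lemma Sigma11_lt_limit b a (X : topologicalType) (A : set X) :
  ord_limit a -> b < a -> Sigma11 b A -> Sigma11 a A.
Proof.
move=> al ba SA; apply/(Sigma11_limitE _ al).
exists (fun=> b), (fun=> snd @^-1` A); split=> // [_|].
  exact: (Sigma11_preimage (@snd_continuous _ _) SA).
by rewrite bigcap_const ?exists_baire_snd.
Qed.

(** Above level 0, the index of the union becomes the first entry of a Baire witness, which the
    projection absorbs. *)
Lemma Sigma11_bigcup a (X : topologicalType) (A : nat -> set X) :
  (forall n, Sigma11 a (A n)) -> Sigma11 a (\bigcup_n A n).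
Proof.
move=> SA; have [a0|an0] := pselect (ord_zero a).
  apply/(Sigma11_zeroE _ a0)/Fsigma_bigcup => n.
  exact/(Sigma11_zeroE _ a0).
rewrite (_ : \bigcup_n _ = exists_baire [set z | A (z.1 0%N) z.2]); last first.
  apply/seteqP; split=> [x [n _ Ax]|x [p Ax]]; last by exists (p 0%N).
  by exists (fun=> n).
apply: Sigma11_exists => //.
apply: (@Sigma11_glue _ (baire * X)%type (fun z => z.1 0%N)
    (fun n => snd @^-1` A n)).
  apply: (locally_constant_precomp (f := fun p : baire => p 0%N)).
    exact: fst_continuous.
  exact: locally_constant_eval.
by move=> n; exact: (Sigma11_preimage (@snd_continuous _ _) (SA n)).
Qed.

(** Witnesses chosen for all [n] at once are joined into one sequence, so the intersection moves
    under a single projection. *)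
Lemma Sigma11_bigcap a (X : topologicalType) (A : nat -> set X) :
  ~ ord_zero a -> (forall n, Sigma11 a (A n)) -> Sigma11 a (\bigcap_n A n).
Proof.
move=> an0 SA.
pose f n (z : baire * X) := (baire_nth n z.1, z.2).
have fc n : continuous (f n).
  apply: pair_continuous (@snd_continuous _ _).
  by apply: comp_continuous (@baire_nth_continuous n); exact: fst_continuous.
have fE (C : nat -> set (baire * X)) :
    \bigcap_n exists_baire (C n) = exists_baire (\bigcap_n (f n @^-1` C n)).
  apply/seteqP; split=> [x Cx|x [p Cp] n _]; last first.
    by exists (baire_nth n p); exact: Cp.
  have /choice[u uP] n : exists p, C n (p, x) by exact: Cx.
  by exists (baire_join u) => n _; rewrite /f /= baire_joinK.
have [//|b ba|al] := ord_case a.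
- have /choice[C CP] n : exists C, Sigma11 b (~` C) /\ A n = exists_baire C.
    exact/(Sigma11_succE _ ba).
  apply/(Sigma11_succE _ ba); exists (\bigcap_n (f n @^-1` C n)); split; last first.
    by rewrite -fE; apply: eq_bigcapr => n _; exact: (CP n).2.
  (* The complement is a countable union at level [b], where [b] may be 0. *)
  rewrite setC_bigcap; apply: Sigma11_bigcup => n.
  exact: (Sigma11_preimage (fc n) (CP n).1).
- have /choice[b /choice[C CP]] n :
      exists (b : nat -> W) (C : nat -> set (baire * X)%type),
      [/\ forall m, b m < a, forall m, Sigma11 (b m) (C m) &
        A n = exists_baire (\bigcap_m C m)].
    exact/(Sigma11_limitE _ al).
  apply/(Sigma11_limitE _ al).
  exists (fun j => b (decode_pair j).1 (decode_pair j).2).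
  exists (fun j => f (decode_pair j).1 @^-1` C (decode_pair j).1 (decode_pair j).2).
  split=> [j|j|]; first by case: (CP (decode_pair j).1).
    apply: Sigma11_preimage => //.
    by case: (CP (decode_pair j).1).
  rewrite (_ : \bigcap_n A n = \bigcap_n exists_baire (\bigcap_m C n m)); last first.
    by apply: eq_bigcapr => n _; case: (CP n).
  rewrite fE; congr exists_baire; apply/seteqP; split=> z Cz.
    by move=> j _; exact: (Cz (decode_pair j).1).
  move=> n _ m _; have := Cz (pickle (n, m)) I.
  by rewrite /= pickle_pairK.
Qed.

Lemma Sigma11_setI a (X : topologicalType) (A B : set X) :
  Sigma11 a A -> Sigma11 a B -> Sigma11 a (A `&` B).
Proof.
move=> SA SB; have [a0|an0] := pselect (ord_zero a).
  apply/(Sigma11_zeroE _ a0).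
  by apply: Fsigma_setI; apply/(Sigma11_zeroE _ a0).
rewrite (_ : A `&` B = \bigcap_n (if n == 0%N then A else B)); last first.
  apply/seteqP; split=> [x [Ax Bx] n _|x ABx]; first by case: ifP.
  by split; [exact: (ABx 0%N)|exact: (ABx 1%N)].
by apply: Sigma11_bigcap => // n; case: ifP.
Qed.

(** Induction on [a] reduces to the single step from its predecessor [c], settled by how the set
    arises at level [c]. The bottom level is where open sets must be F_sigma. *)
Lemma Sigma11_lt a b (X : topologicalType) (A : set X) :
  baire_retract X -> b < a -> Sigma11 b A -> Sigma11 a A.
Proof.
elim/(well_founded_ind wfW): a b X A => a IH b X A rX ba SA.
have [a0|c ca|al] := ord_case a; last exact: Sigma11_lt_limit SA.
  by have := a0 b; rewrite leNgt ba.
have {b ba SA} SA : Sigma11 c A.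
  have := ord_succ_le ca ba; rewrite le_eqVlt => /orP[/eqP <-//|bc].
  exact: (IH _ ca.1 _ _ _ rX bc).
case: SA => [c0 [F Fc ->]|e D ec SD ->|e D cl ec SD ->].
(* The index of the F_sigma union becomes the first entry of the witness; the complement of the
   matrix is then glued from open sets. *)
- apply/(Sigma11_succE _ ca); exists [set z | F (z.1 0%N) z.2]; split; last first.
    apply/seteqP; split=> [x [n _ Fx]|x [p Fx]]; last by exists (p 0%N).
    by exists (fun=> n).
  apply: (@Sigma11_glue _ (baire * X)%type (fun z => z.1 0%N)
    (fun n => snd @^-1` (~` F n))).
    apply: (locally_constant_precomp (f := fun p : baire => p 0%N)).
      exact: fst_continuous.
    exact: locally_constant_eval.
  move=> n; apply: Sigma11_preimage; first exact: snd_continuous.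
  by apply/(Sigma11_zeroE _ c0)/open_Fsigma => //; exact: closed_openC.
- apply/(Sigma11_succE _ ca); exists D; split => //.
  exact: (IH _ ca.1 _ _ _ (baire_retract_prod rX) ec.1).
(* The complement of the limit matrix is a countable union; the complement of each [D n] is one
   level above [e n], still below the limit [c]. *)
- apply/(Sigma11_succE _ ca); exists (\bigcap_n D n); split=> //.
  rewrite setC_bigcap; apply: Sigma11_bigcup => n.
  have [e' ee' e'c] := ord_limit_succ cl (ec n).
  apply: (Sigma11_lt_limit cl e'c); apply: (Sigma11_compl_succ ee').
  by rewrite setCK.
Qed.

Lemma Sigma11_Fsigma a (X : topologicalType) (A : set X) :
  baire_retract X -> Fsigma A -> Sigma11 a A.
Proof.
move=> rX FA; elim/(well_founded_ind wfW): a => a IH.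
have [a0|an0] := pselect (ord_zero a); first exact: Sigma11_zero.
by have [b ba] := not_ord_zero an0; exact: (Sigma11_lt rX ba (IH _ ba)).
Qed.

End ordinals.

(** * Sequential spaces and admissible representations *)

Lemma cvg_subseq (X : topologicalType) (u : nat -> X) (x : X) (m : nat -> nat) :
  (forall k, k <= m k)%N -> u @ \oo --> x -> (fun k => u (m k)) @ \oo --> x.
Proof.
move=> km ux U /ux [N _ NU]; exists N => // k /= Nk.
by apply: NU => /=; exact: leq_trans (km k).
Qed.

Definition sequential (X : topologicalType) : Prop :=
  forall U : set X, seq_open U -> open U.

Lemma sequential_locally_constant (X : topologicalType) (T : Type) (f : X -> T) :
  sequential X ->
  (forall (u : nat -> X) (x : X), u @ \oo --> x -> \forall n \near \oo, f (u n) = f x) ->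
  locally_constant f.
Proof.
move=> sX fs x; apply: open_nbhs_nbhs; split => //.
by apply: sX => u y /= <- uy; exact: fs.
Qed.

Lemma seq_top_openE (X : topologicalType) (U : set (seq_top X)) :
  open U = @seq_open X U.
Proof. by []. Qed.

(** The open sets added by sequentializing contain, by definition, a tail of every sequence
    converging into them, so convergence of sequences is unchanged. *)
Lemma cvg_seq_top (X : topologicalType) (u : nat -> X) (x : X) :
  (u : nat -> seq_top X) @ \oo --> (x : seq_top X) <-> u @ \oo --> x.
Proof.
split=> ux U; rewrite nbhsE => -[V [Vo Vx] VU]; apply: (filterS VU).
  apply: ux; apply: (@open_nbhs_nbhs (seq_top X)); split => //.
  by rewrite seq_top_openE => v y Vy vy; apply: vy; exact: open_nbhs_nbhs.
by move: Vo; rewrite seq_top_openE => /(_ u x Vx ux).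
Qed.

Lemma seq_top_sequential (X : topologicalType) : sequential (seq_top X).
Proof.
move=> U Us; rewrite seq_top_openE => u x Ux ux.
by apply: Us Ux _; exact/cvg_seq_top.
Qed.

(** * Convergent sequences in exponentials *)

Section qcb_exp.
Context {X : topologicalType}.
Implicit Types G H : qcb_exp X nat.

Definition qcb_eval G (x : X) : nat := (G : continuousType X nat) x.

Lemma qcb_eval_continuous G : continuous (qcb_eval G).
Proof. exact: (@cts_fun _ _ (G : continuousType X nat)). Qed.

Lemma qcb_eval_locally_constant G : locally_constant (qcb_eval G).
Proof. by apply/continuous_natP; exact: qcb_eval_continuous. Qed.

Definition qcb_fun (f : X -> nat) (fl : locally_constant f) : qcb_exp X nat :=
  (mkcts ((continuous_natP f).2 fl) : continuousType X nat).

Lemma qcb_funE f (fl : locally_constant f) : qcb_eval (qcb_fun fl) = f.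
Proof. by []. Qed.

Lemma qcb_evalP G H : qcb_eval G =1 qcb_eval H -> G = H.
Proof. by move=> GH; exact/continuousEP. Qed.

Lemma cvg_qcb_expP (G_ : nat -> qcb_exp X nat) G :
  G_ @ \oo --> G <-> forall (K : set X) (O : set nat), compact K ->
    qcb_eval G @` K `<=` O -> \forall n \near \oo, qcb_eval (G_ n) @` K `<=` O.
Proof.
pose i (f : continuousType X nat) : {compact-open, X -> nat} := f.
split=> [/cvg_seq_top GG K O cK GKO|GG].
  have ic : continuous (i : initial_topology i -> _) by exact: initial_continuous.
  have : (i \o G_) @ \oo --> i G by exact: cvg_trans (cvg_app _ GG) (ic G).
  by move=> /compact_open_cvgP/(_ K O cK (discrete_open _) GKO).
apply/cvg_seq_top => U [V [[A oA <-] AG] AU]; apply: (filterS AU).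
have : (i \o G_) @ \oo --> i G.
  by apply/compact_open_cvgP => K O cK _ GKO; exact: GG.
by apply; exact: open_nbhs_nbhs.
Qed.

(** A filter on this set that does not cluster at the limit concentrates on finitely many terms, and
    a finite set is compact. *)
Lemma cvg_compact (x_ : nat -> X) (x : X) :
  x_ @ \oo --> x -> compact [set y | y = x \/ exists n, y = x_ n].
Proof.
move=> xx F FF FK; have [xF|] := pselect (cluster F x); first by exists x; split; [left|].
move=> /existsNP[A /existsNP[U /not_implyP[FA /not_implyP[Ux AU0]]]].
have [N _ NU] := xx _ Ux.
have FN : F (x_ @` `I_N).
  apply: filterS (filterI FA FK) => y [Ay Ky].
  have nUy : ~ U y by move=> Uy; apply: AU0; exists y.
  case: Ky => [yx|[n yn]]; first by case: nUy; rewrite yx; exact: nbhs_singleton.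
  exists n => //=; rewrite ltnNge; apply/negP => Nn; apply: nUy.
  by rewrite yn; exact: NU.
have [_ [[n _ <-] clu]] := finite_compact (finite_image x_ (finite_II N)) FF FN.
by exists (x_ n); split => //; right; exists n.
Qed.

(** Compact-open convergence is tested on the compact set formed by [x] and a tail of the sequence
    on which [G] is constant. *)
Lemma cvg_qcb_eval (G_ : nat -> qcb_exp X nat) G (x_ : nat -> X) (x : X) :
  G_ @ \oo --> G -> x_ @ \oo --> x ->
  \forall n \near \oo, qcb_eval (G_ n) (x_ n) = qcb_eval G x.
Proof.
move=> /cvg_qcb_expP GG xx.
have [N _ NG] := cvg_locally_constant (qcb_eval_locally_constant G) xx.
have xNx : (fun n => x_ (N + n)%N) @ \oo --> x by apply: cvg_subseq xx => k; exact: leq_addl.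
have := GG _ [set qcb_eval G x] (cvg_compact xNx).
have /[swap]/[apply] : qcb_eval G @` [set y | y = x \/ exists n, y = x_ (N + n)%N]
    `<=` [set qcb_eval G x].
  move=> _ [y Ky <-] /=; case: Ky => [->//|[n ->]].
  exact: (NG (N + n)%N (leq_addr _ _)).
move=> [M _ MG]; exists (maxn N M) => // n /=; rewrite geq_max => /andP[Nn Mn].
apply: (MG n Mn (qcb_eval (G_ n) (x_ n))); exists (x_ n) => //.
by right; exists (n - N)%N; rewrite /= subnKC.
Qed.

Lemma compact_cluster_seq (K : set X) (x_ : nat -> X) :
  compact K -> (forall n, K (x_ n)) ->
  exists2 x, K x & forall U, nbhs x U -> forall N, exists2 n, (N <= n)%N & U (x_ n).
Proof.
move=> cK Kx; have [|x [Kx' xclu]] := cK (x_ @ \oo) _.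
  by exists 0%N => // n _; exact: Kx.
exists x => // U Ux N.
have FN : (x_ @ \oo) (x_ @` [set n | (N <= n)%N]) by exists N => // n /= Nn; exists n.
by have [_ [[n /= Nn <-] Un]] := xclu _ _ FN Ux; exists n.
Qed.

(** Equivalently, a continuous injection into Baire space. This weak form of metrizability suffices
    to make compact sets sequentially compact. *)
Definition separating (e : nat -> X -> nat) : Prop :=
  (forall i, locally_constant (e i)) /\ forall x y, e^~ x =1 e^~ y -> x = y.

(** Choose terms that agree with a cluster point [x] on more and more separating functions. If
    infinitely many of them avoided a neighbourhood of [x], these would cluster at a point with the
    same values as [x], that is, at [x] itself. *)
Lemma compact_seq_compact (e : nat -> X -> nat) (K : set X) (x_ : nat -> X) :
  separating e -> compact K -> (forall n, K (x_ n)) ->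
  exists (m : nat -> nat) (x : X), [/\ K x, forall k, (k <= m k)%N & (fun k => x_ (m k)) @ \oo --> x].
Proof.
move=> [el esep] cK Kx; have [x Kx' xclu] := compact_cluster_seq cK Kx.
have agree k : \forall y \near x, forall i, (i < k)%N -> e i y = e i x.
  elim: k => [|k IH]; first exact: nearW.
  near=> y => i; rewrite ltnS leq_eqVlt => /orP[/eqP ->|ik].
    by near: y; exact: el.
  by move: i ik; near: y; exact: IH.
have /choice[m mP] k : exists m, (k <= m)%N /\ forall i, (i < k)%N -> e i (x_ m) = e i x.
  by have [m km mE] := xclu _ (agree k) k; exists m.
exists m, x; split => // [k|U Ux]; first by case: (mP k).
apply: contrapT => nU.
have /choice[l lP] N : exists n, (N <= n)%N /\ ~ U (x_ (m n)).
  apply: contrapT => /forallNP nN; apply: nU; exists N => // n /= Nn.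
  by apply: contrapT => nUn; apply: (nN n).
have [//|x' _ x'clu] := @compact_cluster_seq K (fun k => x_ (m (l k))) cK.
suff xx' : x = x'.
  rewrite xx' in Ux; have [n _ Un] := x'clu _ Ux 0%N.
  exact: (lP n).2.
apply: esep => i; have [n ni /= <-] := x'clu _ (el i x') i.+1.
rewrite (mP (l n)).2//; exact: leq_trans (lP n).1.
Unshelve. all: by end_near. Qed.

(** Converse of [cvg_qcb_eval]: a failure on [K] and [O] yields points of [K] with values outside
    [O] at arbitrarily large indices, and a convergent subsequence of them contradicts the
    hypothesis. *)
Lemma continuous_convergence_qcb_exp (e : nat -> X -> nat)
    (G_ : nat -> qcb_exp X nat) G : separating e ->
  (forall (m : nat -> nat) (x_ : nat -> X) (x : X), (forall k, k <= m k)%N ->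
    x_ @ \oo --> x ->
    \forall k \near \oo, qcb_eval (G_ (m k)) (x_ k) = qcb_eval G x) ->
  G_ @ \oo --> G.
Proof.
move=> esep cc; apply/cvg_qcb_expP => K O cK GKO; apply: contrapT => nG.
have /choice[l lP] N : exists n, (N <= n)%N /\ exists x, K x /\ ~ O (qcb_eval (G_ n) x).
  apply: contrapT => /forallNP nN; apply: nG; exists N => // n /= Nn.
  move=> _ [x Kx <-]; apply: contrapT => nO; apply: (nN n); split => //.
  by exists x.
have /choice[x_ xP] N := (lP N).2.
have [m [x [Kx km xx]]] := compact_seq_compact esep cK (fun n => (xP n).1).
have klm k : (k <= (l \o m) k)%N by exact: leq_trans (km k) (lP _).1.
have [N _ /(_ N (leqnn N)) /= GN] := cc _ _ _ klm xx.
by apply: (xP (m N)).2; rewrite GN; apply: GKO; exists x.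
Qed.

End qcb_exp.

Lemma cvg_qcb_prodP (I : Type) (X : I -> topologicalType)
    (u : nat -> qcb_prod X) (x : qcb_prod X) :
  u @ \oo --> x <-> forall i, (fun n => u n i) @ \oo --> x i.
Proof. by split=> [/cvg_seq_top/cvg_prodP//|ux]; apply/cvg_seq_top/cvg_prodP. Qed.

(** [R q x] reads "the sequence [q] names the point [x]". *)
Record admissible (X : topologicalType) (R : baire -> X -> Prop) : Prop := {
  adm_sequential : sequential X;
  adm_functional : forall q x y, R q x -> R q y -> x = y;
  adm_cvg : forall (q_ : nat -> baire) (q : baire) (x_ : nat -> X) (x : X),
    (forall n, R (q_ n) (x_ n)) -> R q x -> q_ @ \oo --> q -> x_ @ \oo --> x;
  adm_lift : forall (x_ : nat -> X) (x : X), x_ @ \oo --> x ->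
    exists (q_ : nat -> baire) (q : baire),
      [/\ forall n, R (q_ n) (x_ n), R q x & q_ @ \oo --> q];
  adm_separating : exists e, @separating X e;
  adm_retract : exists (r : X -> nat) (t : nat -> X),
    locally_constant r /\ cancel t r }.

Section admissible.
Context {X : topologicalType} {R : baire -> X -> Prop}.
Hypothesis admR : admissible R.

Lemma adm_surj x : exists q, R q x.
Proof.
have [|q_ [q [_ Rqx _]]] := adm_lift admR (x_ := fun=> x) (x := x); last by exists q.
exact: cvg_cst.
Qed.

(** For each finite sequence pick a point with a name extending it, if there is one. Along the
    prefixes of a name of [x] the names of the picked points converge, hence so do the points. *)
Lemma adm_dense : exists e : nat -> X, forall x : X, exists i : nat -> nat,
  (fun k => e (i k)) @ \oo --> x.
Proof.
have [r [t _]] := adm_retract admR.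
pose near_ (s : seq nat) x := exists2 q, R q x & initseg q (size s) = s.
pose pt s := xget (t 0%N) (near_ s).
exists (fun j => pt (odflt [::] (unpickle j))) => x.
have [q Rqx] := adm_surj x.
exists (fun m => pickle (initseg q m)).
have /choice[q_ qP] m : exists q', R q' (pt (initseg q m)) /\
    initseg q' m = initseg q m.
  rewrite /pt; case: xgetP => [y _ [q' Rq' q'q]|/(_ x)[]]; last by exists q; rewrite ?size_initseg.
  by exists q'; rewrite size_initseg in q'q.
apply: (adm_cvg admR (q_ := q_) _ Rqx) => [m|].
  by rewrite pickleK; exact: (qP m).1.
by apply: cvg_initseg => n; exact: (qP n).2.
Qed.

End admissible.

(** * Representations of the continuous functionals *)

(** A name determines its number as a constant sequence, so that quantifying
    over names is a countable quantification. *)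
Definition nat_name (q : baire) (n : nat) : Prop := q = fun=> n.

Lemma admissible_nat : admissible nat_name.
Proof.
split.
- by move=> U _; exact: (@discrete_open nat).
- by move=> q x y -> /(congr1 (@^~ 0%N)).
- move=> q_ q x_ x qx -> /cvg_baireP/(_ 0%N) q0; apply/cvg_natP.
  by apply: filterS q0 => n; rewrite qx.
- move=> x_ x /cvg_natP xx; exists (fun n => fun=> x_ n), (fun=> x); split=> //.
  by apply/cvg_baireP => n.
- exists (fun=> id); split=> [i|x y /(_ 0%N)//].
  by apply/continuous_natP => x; exact: cvg_id.
- exists id, id; split => //.
  by apply/continuous_natP => x; exact: cvg_id.
Qed.

(** A name of [G] is a table of finite sequences: the value [k.+1] at [s]
    asserts that [G] is constantly [k] on the points having a name that
    extends [s], while [0] carries no information. *)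
Definition table (p q : baire) (m : nat) : nat := p (pickle (initseg q m)).

Definition table_value (p q : baire) (k : nat) : Prop :=
  (exists m, table p q m = k.+1) /\
  forall m, table p q m = 0%N \/ table p q m = k.+1.

Lemma table_value_inj p q k l : table_value p q k -> table_value p q l -> k = l.
Proof. by move=> [[m pqm] _] [_ /(_ m)]; rewrite pqm => -[//|[]]. Qed.

Lemma locally_constant_table (X : topologicalType) (f g : X -> baire) m :
  continuous f -> continuous g -> locally_constant (fun x => table (f x) (g x) m).
Proof.
move=> fc gc.
apply: (locally_constant_bind (f := fun x => pickle (initseg (g x) m))
  (g := fun i x => f x i)).
  by apply: locally_constant_comp; exact: locally_constant_initseg.
exact/continuous_baireP.
Qed.

Section exponential.
Context {X : topologicalType} {R : baire -> X -> Prop}.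
Hypothesis admR : admissible R.

Definition exp_name (p : baire) (G : qcb_exp X nat) : Prop :=
  forall q x, R q x -> table_value p q (qcb_eval G x).

(** Otherwise names agreeing with [q] ever further would give points converging to [x], against
    continuous convergence. *)
Lemma cvg_qcb_expW (G_ : nat -> qcb_exp X nat) (G : qcb_exp X nat) q x :
  G_ @ \oo --> G -> R q x ->
  exists m, forall n q' x', (m <= n)%N -> R q' x' ->
    initseg q' m = initseg q m -> qcb_eval (G_ n) x' = qcb_eval G x.
Proof.
move=> GG Rqx; apply: contrapT => /forallNP nm.
have /choice[n /choice[q_ /choice[x_ nP]]] m : exists n q' x',
    [/\ (m <= n)%N, R q' x', initseg q' m = initseg q m &
       qcb_eval (G_ n) x' <> qcb_eval G x].
  apply: contrapT => nP; apply: (nm m) => n q' x' mn Rq'x' q'q.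
  by apply: contrapT => GnG; apply: nP; exists n, q', x'.
have nn m : (m <= n m)%N by case: (nP m).
have xx : x_ @ \oo --> x.
  apply: (adm_cvg admR (q_ := q_) _ Rqx) => [m|]; first by case: (nP m).
  by apply: cvg_initseg => m; case: (nP m).
have [N _ /(_ N (leqnn N)) /=] := cvg_qcb_eval (cvg_subseq nn GG) xx.
by case: (nP N).
Qed.

Definition table_entry (P : set nat) : nat :=
  if pselect (exists c, P c) is left e then (projT1 (cid e)).+1 else 0%N.

Lemma table_entryP P k : table_entry P = k.+1 -> P k.
Proof.
by rewrite /table_entry; case: pselect => // e; case: cid => c Pc /= [<-].
Qed.

Lemma table_entry_neq0 (P : set nat) k : P k -> table_entry P <> 0%N.
Proof. by rewrite /table_entry => Pk; case: pselect => // -[]; exists k. Qed.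

Lemma exp_name_lift (G_ : nat -> qcb_exp X nat) (G : qcb_exp X nat) :
  G_ @ \oo --> G -> exists (p_ : nat -> baire) (p : baire),
    [/\ forall n, exp_name (p_ n) (G_ n), exp_name p G & p_ @ \oo --> p].
Proof.
move=> GG; pose s i : seq nat := odflt [::] (unpickle i).
pose on (s : seq nat) (H : qcb_exp X nat) c := forall q x, R q x ->
  initseg q (size s) = s -> qcb_eval H x = c.
(* An entry of the limit table needs one value valid for all stages from the length of the sequence
   on; it is then also the value of [G]. *)
pose p : baire := fun i =>
  table_entry [set c | forall n, (size (s i) <= n)%N -> on (s i) (G_ n) c].
(* Short sequences copy the limit table, which gives convergence; long ones record [G_ n] alone,
   which makes each table complete. *)
pose p_ n : baire := fun i =>
  if (size (s i) <= n)%N then p i else table_entry (on (s i) (G_ n)).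
have sE q m : s (pickle (initseg q m)) = initseg q m by rewrite /s pickleK.
have ons q m x H c : R q x -> on (initseg q m) H c -> qcb_eval H x = c.
  by move=> Rqx /(_ q x Rqx); rewrite size_initseg; exact.
exists p_, p; split.
- move=> n q x Rqx.
  have sound m k : table (p_ n) q m = k.+1 -> k = qcb_eval (G_ n) x.
    rewrite /table /p_ /p sE size_initseg; case: ifP => [mn|_] /table_entryP.
      by move=> /(_ n mn) /(ons _ _ _ _ _ Rqx).
    by move=> /(ons _ _ _ _ _ Rqx).
  split; last first.
    by move=> m; case E : (table (p_ n) q m) => [|k]; [left|right; rewrite -(sound _ _ E)].
  have [m mP] := cvg_qcb_expW (@cvg_cst _ (G_ n) _ _ _) Rqx.
  (* Length at least [m] makes [G_ n] constant on the prefix; length above [n] selects the entries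
     proper to [G_ n]. *)
  pose M := maxn m n.+1.
  have : table (p_ n) q M <> 0%N.
    rewrite /table /p_ sE size_initseg leqNgt leq_maxr /=.
    apply: (@table_entry_neq0 _ (qcb_eval (G_ n) x)) => q' x' Rq'x'.
    rewrite size_initseg => q'q; apply: (mP m q') => //.
    exact: initseg_leq (leq_maxl _ _) q'q.
  by case E : (table (p_ n) q M) => [//|k] _; exists M; rewrite E (sound _ _ E).
- move=> q x Rqx.
  have sound m k : table p q m = k.+1 -> k = qcb_eval G x.
    rewrite /table /p sE size_initseg => /table_entryP kP.
    have [N _ NG] := cvg_qcb_eval GG (@cvg_cst _ x _ _ _).
    rewrite -(NG (maxn N m) (leq_maxl _ _)).
    by rewrite (ons _ _ _ _ _ Rqx (kP _ (leq_maxr _ _))).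
  split; last first.
    by move=> m; case E : (table p q m) => [|k]; [left|right; rewrite -(sound _ _ E)].
  have [m mP] := cvg_qcb_expW GG Rqx.
  have : table p q m <> 0%N.
    rewrite /table /p sE size_initseg.
    apply: (@table_entry_neq0 _ (qcb_eval G x)) => n mn q' x' Rq'x'.
    by rewrite size_initseg; exact: mP.
  by case E : (table p q m) => [//|k] _; exists m; rewrite E (sound _ _ E).
- apply/cvg_baireP => i; exists (size (s i)) => // n /= sn.
  by rewrite /p_ sn.
Qed.

(** Convergent arguments lift to convergent names. A single entry of [p] decides the value at the
    limit, and it is eventually shared by the approximating tables and names. *)
Lemma exp_name_cvg (p_ : nat -> baire) (p : baire) (G_ : nat -> qcb_exp X nat)
    (G : qcb_exp X nat) :
  (forall n, exp_name (p_ n) (G_ n)) -> exp_name p G -> p_ @ \oo --> p ->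
  G_ @ \oo --> G.
Proof.
move=> pG_ pG pp; have [e esep] := adm_separating admR.
apply: (continuous_convergence_qcb_exp esep) => m x_ x km xx.
have [q_ [q [Rq_ Rq qq]]] := adm_lift admR xx.
have [[l lE] _] := pG _ _ Rq.
have := cvg_subseq km pp => /cvg_baireP/(_ (pickle (initseg q l))).
have id_cont : continuous (@id baire) by move=> z; exact: cvg_id.
have := cvg_locally_constant (locally_constant_initseg l id_cont) qq.
apply: filterS2 => k qE pE.
have [_ /(_ l)] := pG_ (m k) _ _ (Rq_ k).
by rewrite {1 2}/table qE pE -/(table p q l) lE => -[//|[->]].
Qed.

Lemma locally_constant_qcb_evalr x :
  locally_constant (fun G : qcb_exp X nat => qcb_eval G x).
Proof.
apply: sequential_locally_constant => [|G_ G GG]; first exact: seq_top_sequential.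
exact: cvg_qcb_eval GG (cvg_cst _).
Qed.

Lemma admissible_exp : admissible exp_name.
Proof.
split.
- exact: seq_top_sequential.
- move=> p G H pG pH; apply: qcb_evalP => x.
  have [q Rqx] := adm_surj admR x.
  exact: table_value_inj (pG _ _ Rqx) (pH _ _ Rqx).
- exact: exp_name_cvg.
- exact: exp_name_lift.
(* A functional is determined by its values on a dense sequence. *)
- have [e eP] := adm_dense admR.
  exists (fun i G => qcb_eval G (e i)); split=> [i|G H GH].
    exact: locally_constant_qcb_evalr.
  apply: qcb_evalP => x; have [i ix] := eP x.
  have := cvg_locally_constant (qcb_eval_locally_constant G) ix.
  have [N _ HN] := cvg_locally_constant (qcb_eval_locally_constant H) ix.
  move=> [M _ GM]; rewrite -(GM (maxn M N) (leq_maxl _ _)).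
  by rewrite -(HN (maxn M N) (leq_maxr _ _)) /= GH.
- have [r [t _]] := adm_retract admR.
  exists (fun G => qcb_eval G (t 0%N)), (fun n => qcb_fun (locally_constant_cst n)).
  by split=> //; exact: locally_constant_qcb_evalr.
Qed.

End exponential.

Lemma dependent_function_choice (I : Type) (X : I -> Type)
    (P : forall i, X i -> Prop) :
  (forall i, exists x, P i x) -> exists f, forall i, P i (f i).
Proof.
by move=> Px; exists (fun i => projT1 (cid (Px i))) => i; case: cid.
Qed.

Section product.
Context {I : Type} {X : I -> topologicalType} {R : forall i, baire -> X i -> Prop}.
Hypothesis admR : forall i, admissible (@R i).
Variable c : I -> nat.
Hypothesis c_inj : injective c.

Definition prod_name (q : baire) (x : qcb_prod X) : Prop :=
  forall i, R (baire_nth (c i) q) (x i).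

Definition index_of (n : nat) : option I :=
  if pselect (exists i, c i = n) is left e then Some (projT1 (cid e)) else None.

Lemma index_ofK i : index_of (c i) = Some i.
Proof.
rewrite /index_of; case: pselect => [e|[]]; last by exists i.
by case: cid => j /= /c_inj ->.
Qed.

Lemma continuous_qcb_prod_proj i : continuous (fun x : qcb_prod X => x i).
Proof.
apply/continuousP => U Uo; apply: (@seq_top_sequential (prod_topology X)).
move=> u x Ux /cvg_qcb_prodP/(_ i); apply.
exact: open_nbhs_nbhs.
Qed.

Lemma admissible_prod (i0 : I) : admissible prod_name.
Proof.
split.
- exact: seq_top_sequential.
- move=> q x y qx qy; apply: functional_extensionality_dep => i.
  exact: (adm_functional (admR i) (qx i) (qy i)).
- move=> q_ q x_ x qx_ qx qq; apply/cvg_qcb_prodP => i.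
  apply: (adm_cvg (admR i) (q_ := fun n => baire_nth (c i) (q_ n)) _ (qx i)).
    by move=> n; exact: qx_.
  exact: (cvg_trans (cvg_app _ qq) (@baire_nth_continuous (c i) q)).
- move=> x_ x /cvg_qcb_prodP xx.
  have /choice[q_ /choice[q qP]] i : exists (q_ : nat -> baire) (q : baire),
      [/\ forall n, R (q_ n) (x_ n i), R q (x i) & q_ @ \oo --> q].
    exact: adm_lift.
  pose at_ (f : I -> baire) j : baire :=
    if index_of j is Some i then f i else fun=> 0%N.
  have atE f i : baire_nth (c i) (baire_join (at_ f)) = f i.
    by rewrite baire_joinK /at_ index_ofK.
  exists (fun n => baire_join (at_ (q_^~ n))), (baire_join (at_ q)); split.
  + by move=> n i; rewrite atE; case: (qP i).
  + by move=> i; rewrite atE; case: (qP i).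
  + apply/cvg_baireP => k; rewrite /baire_join /at_.
    case: (index_of _) => [i|]; last exact: nearW.
    by case: (qP i) => _ _ /cvg_baireP; exact.
- have /dependent_function_choice[e eP] i : exists e, @separating (X i) e by exact: adm_separating.
  exists (fun j x => if index_of (decode_pair j).1 is Some i
    then e i (decode_pair j).2 (x i) else 0%N); split.
    move=> j; case: (index_of _) => [i|]; last exact: locally_constant_cst.
    apply: (locally_constant_precomp (@continuous_qcb_prod_proj i)).
    exact: (eP i).1.
  move=> x y xy; apply: functional_extensionality_dep => i.
  apply: (eP i).2 => k; have := xy (pickle (c i, k)).
  by rewrite pickle_pairK /= index_ofK.
- have /dependent_function_choice[r /dependent_function_choice[t rP]] i : exists (r : X i -> nat) (t : nat -> X i),
      locally_constant r /\ cancel t r by exact: adm_retract.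
  exists (fun x => r i0 (x i0)), (fun n i => t i n); split.
    apply: (locally_constant_precomp (@continuous_qcb_prod_proj i0)).
    exact: (rP i0).1.
  by move=> n; exact: (rP i0).2.
Qed.

End product.

(** * Complexity of the set of names *)

(** The equivalence of names; its diagonal is the set of names. *)
Definition same_name (X : Type) (R : baire -> X -> Prop) : set (baire * baire) :=
  [set e | exists2 x, R e.1 x & R e.2 x].

Section table_conflict.

Let names : topologicalType := ((baire * baire) * (baire * baire))%type.

(** The intended [w.1] is a pair of names of one argument and [w.2] a pair of tables; this is the
    complement of the G_delta matching condition. *)
Definition table_conflict : set names := [set w |
  ~ [/\ exists m, table w.2.1 w.1.1 m <> 0%N,
        exists m, table w.2.2 w.1.2 m <> 0%N
      & forall m m', table w.2.1 w.1.1 m <> 0%N ->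
          table w.2.2 w.1.2 m' <> 0%N ->
          table w.2.1 w.1.1 m = table w.2.2 w.1.2 m']].

Lemma table_conflict_Fsigma : Fsigma table_conflict.
Proof.
have c11 : continuous (fun w : names => w.1.1).
  by apply: comp_continuous; exact: fst_continuous.
have c12 : continuous (fun w : names => w.1.2).
  by apply: comp_continuous; [exact: fst_continuous|exact: snd_continuous].
have c21 : continuous (fun w : names => w.2.1).
  by apply: comp_continuous; [exact: snd_continuous|exact: fst_continuous].
have c22 : continuous (fun w : names => w.2.2).
  by apply: comp_continuous; exact: snd_continuous.
have l1 m : locally_constant (fun w : names => table w.2.1 w.1.1 m).
  exact: locally_constant_table.
have l2 m : locally_constant (fun w : names => table w.2.2 w.1.2 m).
  exact: locally_constant_table.
(* Pieces 0 and 1: a table is silent along its name. The others: two informative entries disagree,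
   one piece for each pair of lengths. *)
pose F (j : nat) : set names := match j with
  | 0 => \bigcap_m [set w | table w.2.1 w.1.1 m = 0%N]
  | 1 => \bigcap_m [set w | table w.2.2 w.1.2 m = 0%N]
  | j.+2 => [set w |
      let k := table w.2.1 w.1.1 (decode_pair j).1 in
      let l := table w.2.2 w.1.2 (decode_pair j).2 in
      [/\ k <> 0, l <> 0 & k <> l]%N]
  end.
exists F.
  move=> [|[|j]].
  - apply: closed_bigI => m _; apply: locally_constant_closed.
    exact: (locally_constant_comp (eq^~ 0%N) (l1 m)).
  - apply: closed_bigI => m _; apply: locally_constant_closed.
    exact: (locally_constant_comp (eq^~ 0%N) (l2 m)).
  - apply: locally_constant_closed; rewrite /F /=.
    exact: (locally_constant_comp2 (fun k l => [/\ k <> 0, l <> 0 & k <> l]%N)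
      (l1 _) (l2 _)).
apply/seteqP; split=> w.
  move=> cw; apply: contrapT => nFw; apply: cw; split.
  - apply: contrapT => /forallNP n; apply: nFw; exists 0%N => // m _.
    exact: contrapT (n m).
  - apply: contrapT => /forallNP n; apply: nFw; exists 1%N => // m _.
    exact: contrapT (n m).
  - move=> m m' k0 l0; apply: contrapT => kl; apply: nFw.
    by exists (pickle (m, m')).+2 => //=; rewrite pickle_pairK.
move=> [[|[|j]] _ /= Fw] [[m1 m1P] [m2 m2P] agree].
- exact/m1P/Fw.
- exact/m2P/Fw.
- by case: Fw => k0 l0; apply; exact: agree.
Qed.

End table_conflict.

(** Absence of conflict forces one value on all names of an argument, so both tables define the same
    function. It is continuous because [X] is sequential and convergent sequences lift to names. *)
Lemma same_exp_nameE (X : topologicalType) (R : baire -> X -> Prop) :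
  admissible R -> same_name (@exp_name X R) =
  [set z | forall e, same_name R e -> ~ table_conflict (e, z)].
Proof.
move=> admR; apply/seteqP; split=> [[p p'] [G /= pG p'G] [q q'] [x /= Rq Rq']|].
  apply; rewrite /=; have [[m mE] mP] := pG _ _ Rq; have [[m' m'E] m'P] := p'G _ _ Rq'.
  split; [by exists m; rewrite mE|by exists m'; rewrite m'E|].
  by move=> i j; case: (mP i) => -> //; case: (m'P j) => ->.
move=> [p p'] /= agree.
have {}agree q q' x : R q x -> R q' x -> [/\ exists m, table p q m <> 0%N,
        exists m, table p' q' m <> 0%N
      & forall m m', table p q m <> 0%N -> table p' q' m' <> 0%N ->
          table p q m = table p' q' m'].
  by move=> Rq Rq'; apply: contrapT; apply: (agree (q, q')); exists x.
have /choice[f fP] x : exists k, exists2 q, R q x & exists m, table p q m = k.+1.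
  have [q Rqx] := adm_surj admR x; have [[m mE] _ _] := agree _ _ _ Rqx Rqx.
  by case E: (table p q m) mE => [//|k] _; exists k, q => //; exists m.
(* First [p'] at any name is compared with [p] at the chosen name; then [p] at any name is compared
   with [p'] at that name. *)
have p'f q x : R q x -> table_value p' q (f x).
  move=> Rqx; have [q0 Rq0x [m0 m0E]] := fP x.
  have [_ [m mE] eq0] := agree _ _ _ Rq0x Rqx.
  have m'P m' : table p' q m' <> 0%N -> table p' q m' = (f x).+1.
    by move=> ?; rewrite -m0E; apply/esym/eq0; rewrite ?m0E.
  split; first by exists m; exact: m'P.
  by move=> m'; have [|/m'P] := pselect (table p' q m' = 0%N); [left|right].
have pf q x : R q x -> table_value p q (f x).
  move=> Rqx; have [[m mE] _ eqq] := agree _ _ _ Rqx Rqx.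
  have [[m0 m0E] _] := p'f _ _ Rqx.
  have m'P m' : table p q m' <> 0%N -> table p q m' = (f x).+1.
    by move=> ?; rewrite -m0E; apply: eqq; rewrite ?m0E.
  split; first by exists m; exact: m'P.
  by move=> m'; have [|/m'P] := pselect (table p q m' = 0%N); [left|right].
have fl : locally_constant f.
  apply: sequential_locally_constant (adm_sequential admR) _ => u x ux.
  have [q_ [q [Rq_ Rq qq]]] := adm_lift admR ux.
  have [[m mE] _] := pf _ _ Rq.
  have tl : locally_constant (fun q => table p q m).
    apply: locally_constant_table; first exact: cst_continuous.
    by move=> z; exact: cvg_id.
  apply: filterS (cvg_locally_constant tl qq) => n; rewrite mE => nE.
  by have [_ /(_ m)] := pf _ _ (Rq_ n); rewrite nE => -[//|[]].
by exists (qcb_fun fl) => q x Rqx; rewrite qcb_funE; [exact: pf|exact: p'f].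
Qed.

Section coded.
Context {d : Order.disp_t} {W : orderType d}.
Hypothesis wfW : well_founded (fun a b : W => a < b).
Implicit Types a b : W.

(** The second clause is what the next exponential needs; at [a = 0] it does
    not follow from the first, as [Sigma11 0] is not closed under
    projection. *)
Definition coded a (X : topologicalType) : Prop :=
  exists R : baire -> X -> Prop, [/\ admissible R,
    Sigma11 a (same_name R) &
    forall b, ord_succ a b -> forall Q : set ((baire * baire) * (baire * baire)),
      Fsigma Q -> Sigma11 b [set z | forall e, same_name R e -> ~ Q (e, z)]].

Lemma baire_retract2 : baire_retract (baire * baire)%type.
Proof. exact/baire_retract_prod/baire_retract_id. Qed.

(** Above level 0 the second clause is automatic: the complement arises by two projections from an
    intersection of sets at level [a]. *)
Lemma coded_neq0 a (X : topologicalType) (R : baire -> X -> Prop) :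
  ~ ord_zero a -> admissible R -> Sigma11 a (same_name R) -> coded a X.
Proof.
move=> an0 admR SR; exists R; split=> // b ab Q FQ.
apply: (Sigma11_compl_succ wfW ab).
pose f (w : baire * (baire * (baire * baire))) := ((w.2.1, w.1), w.2.2).
have f1c : continuous (fst \o f).
  apply: pair_continuous; last exact: fst_continuous.
  by apply: comp_continuous; [exact: snd_continuous|exact: fst_continuous].
have fc : continuous f.
  by apply: pair_continuous f1c _; apply: comp_continuous; exact: snd_continuous.
pose C := (fst \o f) @^-1` same_name R `&` f @^-1` Q.
rewrite (_ : ~` _ = exists_baire (exists_baire C)); last first.
  apply/seteqP; split=> [z /existsNP[[q q'] /not_implyP[Rqq' /contrapT Qz]]|].
    by exists q, q'.
  by move=> z [q [q' [Rqq' Qz]]] /(_ (q, q') Rqq').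
do 2!apply: (Sigma11_exists wfW an0).
apply: (Sigma11_setI wfW); first exact: (Sigma11_preimage wfW f1c).
apply: (Sigma11_preimage wfW fc); apply: (Sigma11_Fsigma wfW) => //.
have r4 := baire_retract_prod (baire_retract_prod baire_retract2).
have [g [r [gc rc gK]]] := r4.
pose h (w : (baire * baire) * (baire * baire)) := (w.1.1, (w.1.2, w.2)).
exists (g \o h), (fun p => let w := r p in ((w.1, w.2.1), w.2.2)); split.
- apply: comp_continuous gc; apply: pair_continuous.
    by apply: comp_continuous; exact: fst_continuous.
  apply: pair_continuous; last exact: snd_continuous.
  by apply: comp_continuous; [exact: fst_continuous|exact: snd_continuous].
- apply: (comp_continuous rc (g := fun w => ((w.1, w.2.1), w.2.2))).
  apply: pair_continuous; last by apply: comp_continuous; exact: snd_continuous.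
  apply: pair_continuous; first exact: fst_continuous.
  by apply: comp_continuous; [exact: snd_continuous|exact: fst_continuous].
- by move=> [[q q'] z]; rewrite /= gK.
Qed.

Lemma coded_nat a : ord_zero a -> coded a nat.
Proof.
move=> a0; exists nat_name; split=> [||b ab Q FQ]; first exact: admissible_nat.
  apply/(Sigma11_zeroE _ a0).
  exists (fun n => \bigcap_m [set e | e.1 m = n /\ e.2 m = n]).
    move=> n; apply: closed_bigI => m _; apply: locally_constant_closed.
    apply: (locally_constant_comp2 (fun k l => k = n /\ l = n)).
      exact: (locally_constant_precomp (@fst_continuous _ _)
        (locally_constant_eval m)).
    exact: (locally_constant_precomp (@snd_continuous _ _)
      (locally_constant_eval m)).
  apply/seteqP; split=> [[q q'] [n /= -> ->]|[q q'] [n _ qn]].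
    by exists n => // m _.
  by exists n; apply/funext => m; have [] := qn m I.
apply: (Sigma11_compl_succ wfW ab); apply/(Sigma11_zeroE _ a0).
(* Only constant sequences are names, so the quantifier over names is a countable union. *)
pose c n : baire * baire := ((fun=> n), (fun=> n)).
rewrite (_ : ~` _ = \bigcup_n [set z | Q (c n, z)]).
  apply: Fsigma_bigcup => n.
  apply: (Fsigma_preimage (f := fun z => (c n, z))) FQ.
  by apply: pair_continuous; [exact: cst_continuous|move=> z; exact: cvg_id].
apply/seteqP; split=> z.
  move=> /existsNP[[q q'] /not_implyP[[n /= -> ->] /contrapT Qz]].
  by exists n.
by move=> [n _ Qz] /(_ (c n)); apply=> //; exists n.
Qed.

Lemma coded_exp b a (X : topologicalType) :
  ord_succ b a -> coded b X -> coded a (qcb_exp X nat).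
Proof.
move=> ba [R [admR _ SR]].
apply: (coded_neq0 (ord_succ_neq0 ba) (admissible_exp admR)).
rewrite (same_exp_nameE admR).
exact: (SR _ ba _ table_conflict_Fsigma).
Qed.

(** Names are compared row by row, which is a countable intersection of conditions of levels below
    [a]. *)
Lemma coded_prod a (X : {b | b < a} -> topologicalType) :
  countable_ord a -> ord_limit a -> (forall i, coded (sval i) (X i)) ->
  coded a (qcb_prod X).
Proof.
move=> /countable_injP[c0 c0_inj] al Xc.
pose c (i : {b | b < a}) := c0 (sval i).
have c_inj : injective c.
  move=> [i ia] [j ja] cij; apply: eq_exist => /=.
  by apply: c0_inj => //; rewrite inE.
have [R RP] := dependent_function_choice Xc.
have admR i : admissible (R i) by case: (RP i).
have [b0 b0a] := not_ord_zero al.1.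
apply: (coded_neq0 al.1 (admissible_prod admR c_inj (exist _ b0 b0a))).
pose f i (e : baire * baire) := (baire_nth (c i) e.1, baire_nth (c i) e.2).
have fc i : continuous (f i).
  apply: pair_continuous.
    by apply: comp_continuous (@baire_nth_continuous _); exact: fst_continuous.
  by apply: comp_continuous (@baire_nth_continuous _); exact: snd_continuous.
rewrite (_ : same_name _ = \bigcap_n
    (if index_of c n is Some i then f i @^-1` same_name (R i) else setT)).
  apply: (Sigma11_bigcap wfW al.1) => n.
  case: (index_of c n) => [i|]; last exact: (Sigma11_cst wfW _ _ True).
  apply: (Sigma11_preimage wfW (fc i)); case: i => b ba.
  by apply: (Sigma11_lt_limit wfW al ba); case: (RP (exist _ b ba)).
apply/seteqP; split=> [[q q'] [x /= qx q'x] n _|[q q'] same].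
  case E : (index_of c n) => [i|//]; exists (x i); [exact: qx|exact: q'x].
have /dependent_function_choice[x xP] i :
    exists x, R i (baire_nth (c i) q) x /\ R i (baire_nth (c i) q') x.
  have := same (c i) I; rewrite index_ofK// => -[x /= ? ?].
  by exists x.
by exists x => i; case: (xP i).
Qed.

Lemma coded_cont_functionals a : countable_ord a -> coded a (cont_functionals wfW a).
Proof.
elim/(well_founded_ind wfW): a => a IH ca.
have {}IH b : b < a -> coded b (cont_functionals wfW b).
  move=> ba; apply: (IH _ ba); apply: sub_countable ca.
  by apply: subset_card_le => c /= cb; exact: lt_trans cb ba.
have [a0|b ba|al] := ord_case a.
- by rewrite cont_functionals0//; exact: coded_nat.
- by rewrite (cont_functionalsS wfW ba); apply: (coded_exp ba); exact: IH ba.1.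
- by rewrite cont_functionals_lim//; apply: coded_prod => // -[b ba]; exact: IH.
Qed.

Lemma coded_range_Sigma11 a (X : topologicalType) (f : X -> baire) :
  ~ ord_zero a -> coded a X -> continuous f -> Sigma11 a (range f).
Proof.
move=> an0 [R [admR SR _]] fc.
pose G : set (baire * baire) := [set z | exists2 x, R z.1 x & f x = z.2].
(* Closing the graph adds no wrong value over a name: approximating pairs give points converging to
   [x] by admissibility, and [f] is continuous. *)
have clG q y x : closure G (q, y) -> R q x -> f x = y.
  move=> Gqy Rqx.
  have id_cont : continuous (@id baire) by move=> z; exact: cvg_id.
  have /choice[q_ /choice[x_ qxP]] n : exists q' x', [/\ R q' x',
      initseg q' n = initseg q n & initseg (f x') n = initseg y n].
    have : nbhs (q, y) [set z | initseg z.1 n = initseg q n /\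
        initseg z.2 n = initseg y n].
      exists ([set q' | initseg q' n = initseg q n],
              [set y' | initseg y' n = initseg y n]) => //.
      by split; exact: (locally_constant_initseg n id_cont).
    move=> /Gqy[[q' y'] [[x' /= Rx' <-] [qq yy]]].
    by exists q', x'.
  have xx : x_ @ \oo --> x.
    apply: (adm_cvg admR (q_ := q_) _ Rqx) => [n|]; first by case: (qxP n).
    by apply: cvg_initseg => n; case: (qxP n).
  have fy : (fun n => f (x_ n)) @ \oo --> (y : baire).
    by apply: cvg_initseg => n; case: (qxP n).
  have ffx : (fun n => f (x_ n)) @ \oo --> f x by exact: (cvg_trans (cvg_app _ xx) (fc x)).
  apply/funext => i; move/cvg_baireP/(_ i): fy => [N _ fyN].
  move/cvg_baireP/(_ i): ffx => [M _ fxM].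
  by rewrite -(fyN (maxn N M) (leq_maxl _ _)) -(fxM (maxn N M) (leq_maxr _ _)).
(* The diagonal of [same_name] says that [q] is a name; the closure then fixes the value at the
   named point. *)
rewrite (_ : range f = exists_baire
    ((fun z => (z.1, z.1)) @^-1` same_name R `&` closure G)); last first.
  apply/seteqP; split=> [_ [x _ <-]|y [q [[x /= Rqx _] Gqy]]]; last first.
    by exists x => //; exact: clG Rqx.
  have [q Rqx] := adm_surj admR x; exists q; split; first by exists x.
  by apply: subset_closure; exists x.
apply: (Sigma11_exists wfW an0); apply: (Sigma11_setI wfW).
  apply: (Sigma11_preimage wfW) SR.
  by apply: pair_continuous; exact: fst_continuous.
apply: (Sigma11_Fsigma wfW); first exact: baire_retract2.
apply: closed_Fsigma.
exact: closed_closure.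
Qed.

End coded.

(** * Continuous images *)

(** A functional [G] encodes both a point [y] and a witness [F] that [y] is in
    the set; that [F] is a witness only has to be tested on a dense sequence. *)
Lemma exp_range (X : topologicalType) (R : baire -> X -> Prop)
    (hit : X -> seq nat -> Prop) (S : set baire) :
  admissible R -> (forall s, locally_constant (hit^~ s)) ->
  S = [set y | exists2 F : X -> nat, locally_constant F &
    forall x, ~ hit x (initseg y (F x))] ->
  S !=set0 ->
  exists h : qcb_exp X nat -> baire, continuous h /\ range h = S.
Proof.
move=> admR hitl SE S0.
have [r [t [rl rK]]] := adm_retract admR.
have [e eP] := adm_dense admR.
pose F (G : qcb_exp X nat) x := (decode_pair (qcb_eval G x)).1.
pose pi (G : qcb_exp X nat) : baire := fun n => (decode_pair (qcb_eval G (t n))).2.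
pose T i G := ~ hit (e i) (initseg (pi G) (F G (e i))).
have pic : continuous pi.
  apply/continuous_baireP => n.
  exact: (locally_constant_comp (fun k => (decode_pair k).2)
    (locally_constant_qcb_evalr (t n))).
have Tl i : locally_constant (T i).
  apply: (locally_constant_comp (fun s => ~ hit (e i) s)).
  apply: (locally_constant_bind (f := F^~ (e i)) (g := fun m G => initseg (pi G) m)).
    exact: (locally_constant_comp (fun k => (decode_pair k).1)
      (locally_constant_qcb_evalr (e i))).
  by move=> m; exact: locally_constant_initseg.
have FE y (f : X -> nat) (fl : locally_constant f) :
    exists G, pi G = y /\ F G = f.
  (* The value at [x] codes [f x] and the entry of [y] at [r x]; as [r] undoes [t], evaluation at
     the [t n] recovers [y]. *)
  have Gl : locally_constant (fun x => pickle (f x, y (r x))).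
    exact: (locally_constant_comp2 (fun m k => pickle (m, y k))).
  exists (qcb_fun Gl); split; apply/funext => x.
    by rewrite /pi qcb_funE pickle_pairK /= rK.
  by rewrite /F qcb_funE pickle_pairK.
have TS : pi @` (\bigcap_i T i) = S.
  rewrite SE; apply/seteqP; split=> [_ [G TG <-]|y [f fl fy]]; last first.
    by have [G [piG FG]] := FE y f fl; exists G => // i _; rewrite /T piG FG.
  have Fl : locally_constant (F G).
    exact: (locally_constant_comp (fun k => (decode_pair k).1)
      (qcb_eval_locally_constant G)).
  (* Being hit is locally constant in the argument, so a hit at [x] would recur on the dense
     sequence. *)
  exists (F G) => // x hitx; have [i ix] := eP x.
  have hl : locally_constant (fun x => hit x (initseg (pi G) (F G x))).
    apply: (locally_constant_bind (g := fun s x => hit x s)) => //.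
    exact: locally_constant_comp Fl.
  have [N _ /(_ N (leqnn N)) /= hN] := cvg_locally_constant hl ix.
  by apply: (TG (i N) I); rewrite hN.
rewrite -TS in S0 *; apply: closed_projection_range => //.
by have [_ [G TG _]] := S0; exists G.
Qed.

(** Covers the complement of the empty set, which is not a range: nothing is ever hit. *)
Lemma exp_range_setT (X : topologicalType) (R : baire -> X -> Prop) :
  admissible R ->
  exists h : qcb_exp X nat -> baire, continuous h /\ range h = setT.
Proof.
move=> admR; apply: (exp_range (hit := fun _ _ => False) admR).
- by move=> s; exact: locally_constant_cst.
- apply/esym; apply/seteqP; split => // y _; exists (fun=> 0%N).
    exact: locally_constant_cst.
  by move=> x [].
- by exists (fun=> 0%N).
Qed.

(** The least index works, as finitely many clopen conditions determine it near each point. *)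
Lemma locally_constant_min (X : topologicalType) (P : nat -> set X)
    (exP : forall x, exists n, P n x) :
  (forall n, locally_constant (P n)) ->
  exists2 F : X -> nat, locally_constant F & forall x, P (F x) x.
Proof.
move=> Pl.
have /choice[F FP] x : exists n, P n x /\ forall m, (m < n)%N -> ~ P m x.
  have e : exists n, `[< P n x >] by have [n Pn] := exP x; exists n; exact/asboolP.
  case: (ex_minnP e) => n /asboolP Pn nmin; exists n; split=> // m mn Pm.
  by have := nmin _ (asboolT Pm); rewrite leqNgt mn.
exists F => [x|x]; last by case: (FP x).
have near_lt n : \forall y \near x, forall m, (m < n)%N -> P m y = P m x.
  elim: n => [|n IH]; first exact: nearW.
  near=> y => m; rewrite ltnS leq_eqVlt => /orP[/eqP ->|mn].
    by near: y; exact: Pl.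
  by move: m mn; near: y; exact: IH.
near=> y.
have Py m : (m < (F x).+1)%N -> P m y = P m x by move: m; near: y; exact: near_lt.
have [PFx Fxmin] := FP x; have [PFy Fymin] := FP y.
apply/eqP; rewrite eqn_leq; apply/andP; split; rewrite leqNgt; apply/negP => lt.
  by apply: (Fymin _ lt); rewrite Py.
by apply: (Fxmin _ lt); rewrite -Py// ltnW.
Unshelve. all: by end_near. Qed.

(** A point off the range differs from each [g x] at some length; a locally constant choice of that
    length is the witness. *)
Lemma exp_range_setC_range (X : topologicalType) (R : baire -> X -> Prop)
    (g : X -> baire) : admissible R -> continuous g -> ~` range g !=set0 ->
  exists h : qcb_exp X nat -> baire, continuous h /\ range h = ~` range g.
Proof.
move=> admR gc.
apply: (exp_range (hit := fun x s => initseg (g x) (size s) = s) admR).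
  move=> s; apply: (locally_constant_comp (eq^~ s)).
  exact: locally_constant_initseg.
apply/seteqP; split=> [y gy|y [F Fl Fy] [x _ gxy]]; last first.
  by apply: (Fy x); rewrite size_initseg gxy.
have [||F Fl FP] := @locally_constant_min X (fun n x => initseg (g x) n <> initseg y n).
- move=> x; apply: contrapT => /forallNP nn; apply: gy; exists x => //.
  apply/funext => n; have /contrapT/initsegP := nn n.+1.
  exact.
- move=> n; apply: (locally_constant_comp (fun s => s <> initseg y n)).
  exact: locally_constant_initseg.
by exists F => // x; rewrite size_initseg; exact: FP.
Qed.

(** The arguments are the indices of the closed pieces; the witness gives the length of a prefix of
    the point whose cylinder misses the piece. *)
Lemma exp_range_setC_Fsigma (A : set baire) : Fsigma A -> ~` A !=set0 ->
  exists h : qcb_exp nat nat -> baire, continuous h /\ range h = ~` A.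
Proof.
move=> [F Fc ->].
have natl (T : Type) (f : nat -> T) : locally_constant f.
  have idl : locally_constant (@id nat).
    by apply/continuous_natP => x; exact: cvg_id.
  exact: (locally_constant_comp f idl).
apply: (exp_range (hit := fun n s => exists2 y, F n y & initseg y (size s) = s)
  admissible_nat) => //.
apply/seteqP; split=> [y nFy|y [f fl fy] [n _ Fy]]; last first.
  by apply: (fy n); exists y => //; rewrite size_initseg.
have /choice[f fP] n : exists m, forall q, initseg q m = initseg y m -> ~ F n q.
  apply: nbhs_initseg; apply: open_nbhs_nbhs; split; first by rewrite openC.
  by move=> Fny; apply: nFy; exists n.
exists f => // n [q Fq]; rewrite size_initseg => /fP; exact.
Qed.

(** * Sets of level [a] as continuous images *)

Section lower_bound.
Context {d : Order.disp_t} {W : orderType d}.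
Hypothesis wfW : well_founded (fun a b : W => a < b).
Implicit Types a b : W.

(** A common point of the ranges is a tuple on which the maps indexed by [D] coincide; this is one
    clopen test for each index and position. *)
Lemma prod_range a (X : {b | b < a} -> topologicalType)
    (g : forall i, X i -> baire) (D : {b | b < a} -> Prop) i0 :
  countable_ord a -> (forall i, inhabited (X i)) -> D i0 ->
  (forall i, D i -> continuous (g i)) ->
  \bigcap_(i in D) range (g i) !=set0 ->
  exists h : qcb_prod X -> baire,
    continuous h /\ range h = \bigcap_(i in D) range (g i).
Proof.
move=> /countable_injP[c0 c0_inj] Xinh D0 gc.
pose c (i : {b | b < a}) := c0 (sval i).
have c_inj : injective c.
  move=> [i ia] [j ja] cij; apply: eq_exist => /=.
  by apply: c0_inj => //; rewrite inE.
pose pi (x : qcb_prod X) := g i0 (x i0).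
pose T (k : nat) : set (qcb_prod X) :=
  if index_of c (decode_pair k).1 is Some i then
    [set x | D i -> g i (x i) (decode_pair k).2 = pi x (decode_pair k).2]
  else setT.
have gl i n : D i -> locally_constant (fun x : qcb_prod X => g i (x i) n).
  move=> /gc/continuous_baireP/(_ n).
  exact: (locally_constant_precomp (@continuous_qcb_prod_proj _ X i)).
have pic : continuous pi by apply/continuous_baireP => n; exact: gl.
have Tl k : locally_constant (T k).
  rewrite /T; case: (index_of _ _) => [i|]; last exact: locally_constant_cst.
  have [Di|nDi] := pselect (D i); last first.
    rewrite (_ : [set x | _] = setT); first exact: locally_constant_cst.
    by apply/seteqP; split=> x //= _ Di.
  apply: (locally_constant_comp2 (fun m n => D i -> m = n)); first exact: gl.
  exact: gl.
have -> : \bigcap_(i in D) range (g i) = pi @` (\bigcap_k T k).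
  apply/seteqP; split=> [y gy|_ [x Tx <-] i Di].
    have /dependent_function_choice[x xP] i : exists x, D i -> g i x = y.
      have [Di|nDi] := pselect (D i); last by have [x] := Xinh i; exists x.
      by have [x _ gxy] := gy _ Di; exists x.
    exists x; last exact: xP.
    by move=> k _; rewrite /T; case: (index_of _ _) => [i|//] Di; rewrite /pi !xP.
  exists (x i) => //; apply/funext => n.
  by have := Tx (pickle (c i, n)) I; rewrite /T pickle_pairK /= index_ofK//; exact.
move=> [_ [x Tx _]]; apply: closed_projection_range => //.
by exists x.
Qed.

Lemma coded_inhabited a (X : topologicalType) : coded a X -> inhabited X.
Proof.
by move=> [R [admR _ _]]; have [r [t _]] := adm_retract admR; constructor; exact: t 0%N.
Qed.

Lemma Sigma11_range a (B : set baire) : countable_ord a -> ~ ord_zero a ->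
  B !=set0 -> Sigma11 a B ->
  exists f : cont_functionals wfW a -> baire, continuous f /\ range f = B.
Proof.
elim/(well_founded_ind wfW): a B => a IH B ca an0 B0 SB.
have cb b : b < a -> countable_ord b.
  move=> ba; apply: sub_countable ca.
  by apply: subset_card_le => c /= cb; exact: lt_trans cb ba.
have split_cont : continuous (fun w => (baire_fst w, baire_snd w)).
  by apply: pair_continuous; [exact: baire_fst_continuous|exact: baire_snd_continuous].
(* Pairing turns a matrix on [baire * baire] into a subset of Baire space, to which the induction
   applies; projection becomes [baire_snd]. *)
pose un (C : set (baire * baire)) : set baire := [set w | C (baire_fst w, baire_snd w)].
have unE C : exists_baire C = baire_snd @` un C.
  apply/seteqP; split=> [y [p Cpy]|_ [w Cw <-]]; last by exists (baire_fst w).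
  by exists (baire_pair p y); rewrite /un /= ?baire_pairK1 baire_pairK2.
have unS b (C : set (baire * baire)) : Sigma11 b C -> Sigma11 b (un C).
  exact: (Sigma11_preimage wfW split_cont).
have project (X : topologicalType) C : B = exists_baire C ->
    (un C !=set0 -> exists h : X -> baire, continuous h /\ range h = un C) ->
    exists f : X -> baire, continuous f /\ range f = B.
  move=> BE hP; have [|h [hc hE]] := hP.
    by move: B0; rewrite BE unE => -[_ [w Cw _]]; exists w.
  exists (baire_snd \o h); split.
    by apply: comp_continuous hc _; exact: baire_snd_continuous.
  by rewrite BE unE -hE image_comp.
case: SB => [//|b C ba SC BE|b C al ba SC BE].
- have [R [admR _ _]] := coded_cont_functionals wfW (cb _ ba.1).
  have {SC} := unS _ _ SC.
  rewrite (cont_functionalsS wfW ba) => SC; apply: (project _ C BE) => C0.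
  have unC : un C = ~` un (~` C).
    by apply/seteqP; split=> w /=; rewrite /un /= notK.
  have [b0|bn0] := pselect (ord_zero b).
    rewrite (cont_functionals0 wfW b0) unC in C0 *.
    by apply: exp_range_setC_Fsigma => //; exact/(Sigma11_zeroE _ b0).
  have [uC0|/nonemptyPn uC0] := pselect (un (~` C) !=set0); last first.
    by rewrite unC uC0 setC0; exact: exp_range_setT admR.
  have [g [gc gE]] := IH _ ba.1 _ (cb _ ba.1) bn0 uC0 SC.
  rewrite unC -gE in C0 *; exact: exp_range_setC_range admR gc C0.
- rewrite cont_functionals_lim//; apply: (project _ _ BE) => C0.
  (* The matrices are grouped by the successor [i] of their level. Level [i] is nonzero, hence
     closed under countable intersections, so the induction presents each group as one range. *)
  pose D (i : {c | c < a}) := exists n, ord_succ (b n) (sval i).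
  pose E (i : {c | c < a}) :=
    \bigcap_(n in [set n | ord_succ (b n) (sval i)]) un (C n).
  have unE' : un (\bigcap_n C n) = \bigcap_(i in D) E i.
    apply/seteqP; split=> [w Cw i _ n _|w Ew n _]; first exact: Cw.
    have [c bc ca'] := ord_limit_succ wfW al (ba n).
    by apply: (Ew (exist _ c ca')) => //; exists n.
  have /dependent_function_choice[g gP] i :
      exists g : cont_functionals wfW (sval i) -> baire,
      D i -> continuous g /\ range g = E i.
    have [Di|nDi] := pselect (D i); last by exists (fun=> (fun=> 0%N)).
    have in0 : ~ ord_zero (sval i) by case: Di => n; exact: ord_succ_neq0.
    have [||g gP] := IH _ (svalP i) (E i) (cb _ (svalP i)) in0; last by exists g.
      by move: C0; rewrite unE' => -[w Ew]; exists w; exact: Ew.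
    rewrite (_ : E i = \bigcap_n
        (if `[< ord_succ (b n) (sval i) >] then un (C n) else setT)); last first.
      apply/seteqP; split=> w Ew n; last first.
        by move=> bi; have := Ew n I; rewrite (asboolT bi).
      by move=> _; case: asboolP => // ?; exact: Ew.
    apply: (Sigma11_bigcap wfW in0) => n; case: asboolP => [bi|_].
      exact: (Sigma11_lt wfW baire_retract_id bi.1 (unS _ _ (SC n))).
    exact: (Sigma11_cst wfW _ _ True).
  have [b1 b0b1 b1a] := ord_limit_succ wfW al (ba 0%N).
  have gE : un (\bigcap_n C n) = \bigcap_(i in D) range (g i).
    by rewrite unE'; apply: eq_bigcapr => i /gP[].
  rewrite gE in C0 *; apply: (prod_range (i0 := exist _ b1 b1a)) C0 => //.
  - move=> i; apply: (@coded_inhabited (sval i)).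
    exact: coded_cont_functionals (cb _ (svalP i)).
  - by exists 0%N.
  - by move=> i /gP[].
Qed.

End lower_bound.

Theorem theorem6p1 (d : Order.disp_t) (W : orderType d)
    (wfW : well_founded (fun a b : W => a < b))
    (alpha : W) (alpha_countable : countable_ord alpha)
    (alpha_neq0 : ~ ord_zero alpha)
    (B : set baire) (B_nonempty : B !=set0) :
  Sigma11 alpha B <->
  exists f : cont_functionals wfW alpha -> baire,
    continuous f /\ range f = B.
Proof.
split=> [|[f [fc <-]]]; first exact: Sigma11_range.
apply: (coded_range_Sigma11 wfW alpha_neq0 _ fc).
exact: coded_cont_functionals.
Qed.
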